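(* The family of quantum automorphism groups of forests is equal to the family of quantum automorphism groups of trees.
   Context: Graphs are finite, simple and undirected, with at least one vertex. A forest is a graph all of whose connected components are trees. A quantum permutation group of size $n$ is a pair $\Gamma=(\mathcal A,p)$ where $\mathcal A=\mathcal O(\Gamma)$ is a unital complex $*$-algebra generated by $p=(p_{ij})_{1\le i,j\le n}$ satisfying relations ($\mathcal P_s$): $p_{ij}^*=p_{ij}=p_{ij}^2$, $\sum_j p_{ij}=1=\sum_j p_{ji}$, $p_{ij}p_{ik}=0=p_{ji}p_{ki}$ for $j\neq k$, and such that there is a unital $*$-morphism $\Delta:\mathcal A\to\mathcal A\otimes\mathcal A$ (algebraic tensor product) with $\Delta(p_{ij})=\sum_k p_{ik}\otimes p_{kj}$. Quantum permutation groups (of possibly different sizes) are identified when isomorphic, i.e. when there is a $*$-isomorphism of the algebras intertwining the comultiplications $\Delta$. The quantum automorphism group $\mathrm{Qu}(G)$ of a graph $G$ is the quantum permutation group whose algebra is the universal unital $*$-algebra generated by $u=(u_{xy})_{x,y\in V(G)}$ with relations ($\mathcal P_s$) and $u\,\mathrm{Adj}(G)=\mathrm{Adj}(G)\,u$, where $\mathrm{Adj}(G)$ is the adjacency matrix. *)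

(* Defs.v *)
From HB Require Import structures.
From mathcomp Require Import all_boot all_order all_algebra.
From mathcomp Require Import complex boolp classical_sets reals.

Set Implicit Arguments.
Unset Strict Implicit.
Unset Printing Implicit Defensive.

Import Order.TTheory GRing.Theory Num.Theory.
Local Open Scope ring_scope.
Local Open Scope quotient_scope.

(* [algType] entails 1 != 0: the zero algebra is not a [starAlgType]. *)
HB.mixin Record isStarAlgebra (C : numClosedFieldType) A
    of GRing.Algebra C A := {
  star : A -> A;
  starK : involutive star;
  starD : {morph star : a b / a + b};
  starM : forall a b : A, star (a * b) = star b * star a;
  starZ : forall (k : C) (a : A), star (k *: a) = k^* *: star a }.

#[short(type="starAlgType")]
HB.structure Definition StarAlgebra (C : numClosedFieldType) :=
  {A of GRing.Algebra C A & isStarAlgebra C A}.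

HB.mixin Record isStarPreserving (C : numClosedFieldType)
    (A B : starAlgType C) (f : A -> B) := {
  star_morph : forall a, f (star a) = star (f a) }.

HB.structure Definition StarMorphism (C : numClosedFieldType)
    (A B : starAlgType C) :=
  {f of @GRing.LRMorphism C A B *:%R f & isStarPreserving C A B f}.

Notation "{ 'starmorphism' A '->' B }" := (@StarMorphism.type _ A B)
  (at level 0, A at level 98, B at level 99,
   format "{ 'starmorphism'  A  ->  B }") : type_scope.

Section StarTheory.
Variables (C : numClosedFieldType) (A : starAlgType C).

Lemma star1 : star (1 : A) = 1.
Proof. by rewrite -[LHS]mulr1 -{2}(starK (1 : A)) -starM mulr1 starK. Qed.

Lemma star0 : star (0 : A) = 0.
Proof. by apply: (addrI (star (0 : A))); rewrite -starD !addr0. Qed.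

Lemma star_sum (I : Type) (r : seq I) (F : I -> A) :
  star (\sum_(i <- r) F i) = \sum_(i <- r) star (F i).
Proof. by apply: (big_morph _ starD star0). Qed.

Definition star_subalgebra (S : A -> Prop) : Prop :=
  [/\ S 1,
      forall (k : C) a b, S a -> S b -> S (k *: a + b),
      forall a b, S a -> S b -> S (a * b)
    & forall a, S a -> S (star a)].

Definition star_generated (X : A -> Prop) : Prop :=
  forall S, star_subalgebra S -> (forall a, X a -> S a) -> forall a, S a.

End StarTheory.

Section Regular.
Variable C : numClosedFieldType.
Let conj_star (a : C^o) : C^o := a^*.
Fact regular_starK : involutive conj_star. Proof. exact: conjCK. Qed.
Fact regular_starD : {morph conj_star : a b / a + b}. Proof. exact: rmorphD. Qed.
Fact regular_starM (a b : C^o) : conj_star (a * b) = conj_star b * conj_star a.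
Proof. by rewrite mulrC; exact: rmorphM. Qed.
Fact regular_starZ (k : C) (a : C^o) : conj_star (k *: a) = k^* *: conj_star a.
Proof. exact: rmorphM. Qed.
HB.instance Definition _ := isStarAlgebra.Build C C^o
  regular_starK regular_starD regular_starM regular_starZ.
End Regular.

Lemma linear_functional (K : fieldType) (V : lmodType K) (a : V) :
  a != 0 -> exists f : {linear V -> K^o}, f a = 1.
Proof.
move=> a0.
pose sub (M : set V) := (forall k x y, M x -> M y -> M (k *: x + y)) /\ ~ M a.
have [|M [[ML Ma] Mmax]] := @Zorn_bigcup V sub.
  move=> F FS Ftot; split=> [k x y [X FX Xx] [Y FY Yy]|[X FX Xa]]; last first.
    by have [_] := FS X FX; exact.
  have [XY|YX] := Ftot X Y FX FY.
    by exists Y => //; apply: (FS Y FY).1 => //; exact: XY.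
  by exists X => //; apply: (FS X FX).1 => //; exact: YX.
have M0 : M 0.
  have [[x Mx]|nM] := pselect (exists x, M x).
    by have := ML (-1) x x Mx Mx; rewrite scaleN1r addNr.
  case: (Mmax [set 0]%classic); first split.
  - by move=> x Mx; case: nM; exists x.
  - by move/(_ 0 erefl) => Mx; apply: nM; exists 0.
  - split=> [k x y -> ->|/= aE]; first by rewrite scaler0 addr0.
    by rewrite aE eqxx in a0.
have MZ k x : M x -> M (k *: x) by move=> Mx; rewrite -[_ *: _]addr0; exact: ML.
have Mdec x : exists k, M (x - k *: a).
  apply: contrapT => nk.
  apply: (Mmax (fun y => exists c, M (y - c *: x))); first split.
  - by move=> y My; exists 0; rewrite scale0r subr0.
  - move=> /(_ x) Nx; apply: nk; exists 0; rewrite scale0r subr0.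
    by apply: Nx; exists 1; rewrite scale1r subrr.
  split=> [k y z [c Mc] [d Md]|[c]].
    exists (k * c + d); have := ML k _ _ Mc Md; congr M.
    by rewrite scalerBr scalerA scalerDl opprD addrACA.
  have [->|c0] := eqVneq c 0; first by rewrite scale0r subr0.
  move=> /(MZ (- c^-1)); rewrite scalerBr scalerA mulNr mulVf // scaleN1r opprK.
  by move=> Mx; apply: nk; exists c^-1; rewrite addrC -scaleNr.
have Muniq x k l : M (x - k *: a) -> M (x - l *: a) -> k = l.
  move=> Mk Ml; apply/eqP; rewrite -subr_eq0; apply/eqP.
  have [//|kl0] := eqVneq (k - l) 0; case: Ma.
  have := ML (-1) _ _ Mk Ml; rewrite scaleN1r opprB addrA subrK -scalerBl.
  by move=> /(MZ (k - l)^-1); rewrite scalerA mulVf // scale1r.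
have [f fP] := choice Mdec.
have fL : linear (f : V -> K^o).
  move=> k x y; apply: (Muniq (k *: x + y)) => //.
  have := ML k _ _ (fP x) (fP y); congr M.
  by rewrite scalerBr scalerA scalerDl opprD addrACA.
pose g := HB.pack_for {linear V -> K^o} (f : V -> K^o)
  (GRing.isLinear.Build K V K^o *:%R f fL).
by exists g; apply: (Muniq a) => //; rewrite scale1r subrr.
Qed.

Record balanced (C : numClosedFieldType) (A B : starAlgType C) (W : zmodType)
    (f : A -> B -> W) : Prop := Balanced {
  balDl : forall a a' b, f (a + a') b = f a b + f a' b;
  balDr : forall a b b', f a (b + b') = f a b + f a b';
  balZ : forall (k : C) a b, f (k *: a) b = f a (k *: b) }.

Section Tensor.
Variables (C : numClosedFieldType) (A B : starAlgType C).

(* A list [:: (a1, b1); ...; (an, bn)] stands for the formal sum of the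
   ai (x) bi; two of them are identified when every C-balanced biadditive
   map into an abelian group sends them to the same element.  The lemmas
   [tliftDE], [tlift_pure] and [tlift_uniq] are the universal property of
   A (x)_C B. *)
Definition tpre := seq (A * B).
HB.instance Definition _ := gen_eqMixin tpre.
HB.instance Definition _ := gen_choiceMixin tpre.

Definition teval (W : zmodType) (f : A -> B -> W) (s : tpre) : W :=
  \sum_(x <- s) f x.1 x.2.

Definition tequiv (s t : tpre) : Prop :=
  forall (W : zmodType) (f : A -> B -> W), balanced f -> teval f s = teval f t.

Definition tequivb (s t : tpre) : bool := `[< tequiv s t >].

Lemma tequivb_refl : reflexive tequivb.
Proof. by move=> s; apply/asboolP. Qed.
Lemma tequivb_sym : symmetric tequivb.
Proof.
by move=> s t; apply/asboolP/asboolP => h W f hf; rewrite (h W f hf).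
Qed.
Lemma tequivb_trans : transitive tequivb.
Proof.
move=> t s r /asboolP h /asboolP h'; apply/asboolP => W f hf.
by rewrite (h W f hf) h'.
Qed.

Canonical tequiv_rel := EquivRel tequivb tequivb_refl tequivb_sym tequivb_trans.

Definition tensor := {eq_quot tequiv_rel}.
HB.instance Definition _ := Choice.on tensor.

Definition tmk (s : tpre) : tensor := \pi_tensor s.
Definition tlift (W : zmodType) (f : A -> B -> W) (x : tensor) : W :=
  teval f (repr x).

Lemma tmkP s t : tequiv s t <-> tmk s = tmk t.
Proof.
split; first by move=> h; apply/eqmodP/asboolP.
by move/eqmodP/asboolP.
Qed.

Lemma tmkK x : tmk (repr x) = x. Proof. exact: reprK. Qed.

Lemma repr_tmk s : tequiv (repr (tmk s)) s.
Proof. by apply/tmkP; rewrite tmkK. Qed.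

Lemma tlift_mk (W : zmodType) (f : A -> B -> W) s :
  balanced f -> tlift f (tmk s) = teval f s.
Proof. exact: repr_tmk. Qed.

Lemma tensor_eqP (x y : tensor) :
  (forall (W : zmodType) (f : A -> B -> W), balanced f -> tlift f x = tlift f y)
  <-> x = y.
Proof.
split=> [h|->//]; rewrite -(tmkK x) -(tmkK y); apply/tmkP => W f hf.
exact: h.
Qed.

Definition tzero := tmk [::].
Definition tadd (x y : tensor) := tmk (repr x ++ repr y).
Definition topp (x : tensor) := tmk [seq (- p.1, p.2) | p <- repr x].
Definition tscale (k : C) (x : tensor) := tmk [seq (k *: p.1, p.2) | p <- repr x].
Definition tone := tmk [:: (1, 1)].
Definition tmul (x y : tensor) :=
  tmk [seq (p.1 * q.1, p.2 * q.2) | p <- repr x, q <- repr y].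
Definition tstar (x : tensor) := tmk [seq (star p.1, star p.2) | p <- repr x].
Definition tpure (a : A) (b : B) := tmk [:: (a, b)].

Section Balanced.
Variables (W : zmodType) (f : A -> B -> W).
Hypothesis hf : balanced f.

Lemma bal0l b : f 0 b = 0.
Proof. by apply: (addrI (f 0 b)); rewrite -balDl // !addr0. Qed.
Lemma bal0r a : f a 0 = 0.
Proof. by apply: (addrI (f a 0)); rewrite -balDr // !addr0. Qed.
Lemma balNl a b : f (- a) b = - f a b.
Proof. by apply: (addrI (f a b)); rewrite -balDl // !subrr bal0l. Qed.
Lemma bal_suml (I : Type) (r : seq I) (F : I -> A) b :
  f (\sum_(i <- r) F i) b = \sum_(i <- r) f (F i) b.
Proof.
apply: (big_morph (f^~ b)); [by move=> a a'; rewrite balDl|exact: bal0l].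
Qed.
Lemma bal_sumr (I : Type) (r : seq I) a (F : I -> B) :
  f a (\sum_(i <- r) F i) = \sum_(i <- r) f a (F i).
Proof.
apply: (big_morph (f a)); [by move=> b b'; rewrite balDr|exact: bal0r].
Qed.

Lemma balanced_mulr a b : balanced (fun a' b' => f (a' * a) (b' * b)).
Proof.
split=> *; rewrite ?mulrDl ?balDl ?balDr //.
by rewrite -!scalerAl balZ.
Qed.
Lemma balanced_mull a b : balanced (fun a' b' => f (a * a') (b * b')).
Proof.
split=> *; rewrite ?mulrDr ?balDl ?balDr //.
by rewrite -!scalerAr balZ.
Qed.
Lemma balanced_star : balanced (fun a b => f (star a) (star b)).
Proof. by split=> *; rewrite ?starD ?balDl ?balDr ?starZ ?balZ. Qed.
Lemma balanced_scale k : balanced (fun a b => f (k *: a) b).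
Proof.
split=> *; rewrite ?scalerDr ?balDl ?balDr //.
by rewrite scalerA mulrC -scalerA balZ.
Qed.

End Balanced.

Lemma teval_sum (W : zmodType) (I : Type) (r : seq I) (F : I -> A -> B -> W) s :
  teval (fun a b => \sum_(i <- r) F i a b) s = \sum_(i <- r) teval (F i) s.
Proof. by rewrite /teval exchange_big. Qed.

Section Lift.
Variables (W : zmodType) (f : A -> B -> W).
Hypothesis hf : balanced f.

Lemma tlift0 : tlift f tzero = 0.
Proof. by rewrite tlift_mk // /teval big_nil. Qed.
Lemma tliftD x y : tlift f (tadd x y) = tlift f x + tlift f y.
Proof. by rewrite tlift_mk // /teval big_cat. Qed.
Lemma tliftN x : tlift f (topp x) = - tlift f x.
Proof.
rewrite tlift_mk // /teval big_map (big_morph _ (@opprD W) (oppr0 _)).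
by apply: eq_bigr => p _; rewrite balNl.
Qed.
Lemma tlift_pure a b : tlift f (tpure a b) = f a b.
Proof. by rewrite tlift_mk // /teval big_seq1. Qed.
Lemma tlift_scale k x : tlift f (tscale k x) = tlift (fun a b => f (k *: a) b) x.
Proof. by rewrite tlift_mk // /teval big_map. Qed.
Lemma tlift_star x : tlift f (tstar x) = tlift (fun a b => f (star a) (star b)) x.
Proof. by rewrite tlift_mk // /teval big_map. Qed.
Lemma tlift_mul x y : tlift f (tmul x y) =
  tlift (fun a b => tlift (fun a' b' => f (a * a') (b * b')) y) x.
Proof. by rewrite tlift_mk // /teval big_allpairs_dep. Qed.
End Lift.

Lemma eq_tlift (W : zmodType) (f g : A -> B -> W) x :
  (forall a b, f a b = g a b) -> tlift f x = tlift g x.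
Proof. by move=> h; apply: eq_bigr. Qed.

Lemma tlift_addf (W : zmodType) (f g : A -> B -> W) x :
  tlift (fun a b => f a b + g a b) x = tlift f x + tlift g x.
Proof. by rewrite /tlift /teval big_split. Qed.

Lemma tlift_exchange (W : zmodType) (f : A -> B -> A -> B -> W) x y :
  tlift (fun a b => tlift (fun a' b' => f a b a' b') y) x =
  tlift (fun a' b' => tlift (fun a b => f a b a' b') x) y.
Proof. by rewrite /tlift /teval exchange_big. Qed.

Lemma balanced_tlift (W : zmodType) (f : A -> B -> W) y :
  balanced f ->
  balanced (fun a b => tlift (fun a' b' => f (a * a') (b * b')) y).
Proof.
move=> hf; split=> [a a' b|a b b'|k a b].
- by rewrite -tlift_addf; apply: eq_tlift => c d; rewrite mulrDl balDl.
- by rewrite -tlift_addf; apply: eq_tlift => c d; rewrite mulrDl balDr.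
- by apply: eq_tlift => c d; rewrite -!scalerAl balZ.
Qed.

Local Ltac tens := apply/tensor_eqP => W f hf.

Fact taddA : associative tadd.
Proof. by move=> x y z; tens; rewrite !tliftD // addrA. Qed.
Fact taddC : commutative tadd.
Proof. by move=> x y; tens; rewrite !tliftD // addrC. Qed.
Fact tadd0 : left_id tzero tadd.
Proof. by move=> x; tens; rewrite tliftD // tlift0 // add0r. Qed.
Fact taddN : left_inverse tzero topp tadd.
Proof. by move=> x; tens; rewrite tliftD // tliftN // tlift0 // addNr. Qed.

HB.instance Definition _ :=
  GRing.isZmodule.Build tensor taddA taddC tadd0 taddN.

Lemma tliftDE (W : zmodType) (f : A -> B -> W) (x y : tensor) : balanced f ->
  tlift f (x + y) = tlift f x + tlift f y.
Proof. by move=> hf; rewrite tliftD. Qed.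

Fact tmulA : associative tmul.
Proof.
move=> x y z; tens; rewrite !tlift_mul //; last exact: balanced_tlift.
apply: eq_tlift => a b; rewrite tlift_mul; last exact: balanced_mull.
by do 2!apply: eq_tlift => ? ?; rewrite !mulrA.
Qed.
Fact tmul1r : left_id tone tmul.
Proof.
move=> x; tens; rewrite tlift_mul // tlift_pure; last exact: balanced_tlift.
by apply: eq_tlift => a b; rewrite !mul1r.
Qed.
Fact tmulr1 : right_id tone tmul.
Proof.
move=> x; tens; rewrite tlift_mul //; apply: eq_tlift => a b.
by rewrite tlift_pure ?mulr1 //; exact: balanced_mull.
Qed.
Fact tmulDl : left_distributive tmul (+%R : tensor -> tensor -> tensor).
Proof.
move=> x y z; tens; rewrite tliftDE // !tlift_mul // tliftDE //.
exact: balanced_tlift.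
Qed.
Fact tmulDr : right_distributive tmul (+%R : tensor -> tensor -> tensor).
Proof.
move=> x y z; tens; rewrite tliftDE // !tlift_mul // -tlift_addf.
by apply: eq_tlift => a b; rewrite tliftDE //; exact: balanced_mull.
Qed.

Fact tone_neq0 : tone != 0.
Proof.
have [f f1] := linear_functional (oner_neq0 A).
have [g g1] := linear_functional (oner_neq0 B).
have hfg : balanced (fun a b => f a * g b).
  split=> *; rewrite ?raddfD ?mulrDl ?mulrDr // !linearZ /=.
  by rewrite -scalerAl scalerAr.
apply/eqP => /(congr1 (tlift (fun a b => f a * g b))).
rewrite tlift0 // tlift_pure // f1 g1 mulr1 => /eqP.
by rewrite oner_eq0.
Qed.

HB.instance Definition _ :=
  GRing.Zmodule_isNzRing.Build tensor tmulA tmul1r tmulr1 tmulDl tmulDr tone_neq0.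

Fact tscaleA k l (x : tensor) : tscale k (tscale l x) = tscale (k * l) x.
Proof.
tens; rewrite !tlift_scale //; last exact: balanced_scale.
by apply: eq_tlift => a b; rewrite scalerA.
Qed.
Fact tscale1 : left_id 1 tscale.
Proof.
by move=> x; tens; rewrite tlift_scale //; apply: eq_tlift => a b; rewrite scale1r.
Qed.
Fact tscaleDr : right_distributive tscale +%R.
Proof.
move=> k x y; tens; rewrite tlift_scale // !tliftDE // ?tlift_scale //.
exact: balanced_scale.
Qed.
Fact tscaleDl (x : tensor) : {morph tscale^~ x : k l / k + l}.
Proof.
move=> k l; tens; rewrite tliftDE // !tlift_scale // -tlift_addf.
by apply: eq_tlift => a b; rewrite scalerDl balDl.
Qed.

HB.instance Definition _ := GRing.Zmodule_isLmodule.Build C tensor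
  tscaleA tscale1 tscaleDr tscaleDl.

Fact tscaleAl (k : C) (x y : tensor) : k *: (x * y) = (k *: x) * y.
Proof.
tens; rewrite tlift_scale // !tlift_mul //; last exact: balanced_scale.
rewrite tlift_scale; last exact: balanced_tlift.
by do 2!apply: eq_tlift => ? ?; rewrite scalerAl.
Qed.
Fact tscaleAr (k : C) (x y : tensor) : k *: (x * y) = x * (k *: y).
Proof.
tens; rewrite tlift_scale // !tlift_mul //; last exact: balanced_scale.
apply: eq_tlift => a b; rewrite tlift_scale; last exact: balanced_mull.
by apply: eq_tlift => ? ?; rewrite scalerAr.
Qed.
Fact tstarK : involutive tstar.
Proof.
move=> x; tens; rewrite !tlift_star //; last exact: balanced_star.
by apply: eq_tlift => a b; rewrite !starK.
Qed.
Fact tstarD : {morph tstar : x y / x + y}.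
Proof.
move=> x y; tens; rewrite tliftDE // !tlift_star // tliftDE //.
exact: balanced_star.
Qed.
Fact tstarM (x y : tensor) : tstar (x * y) = tstar y * tstar x.
Proof.
tens; rewrite tlift_star // !tlift_mul //; last exact: balanced_star.
rewrite tlift_star; last exact: balanced_tlift.
rewrite tlift_exchange; apply: eq_tlift => a b.
rewrite tlift_star; last exact: balanced_mull.
by apply: eq_tlift => ? ?; rewrite !starM.
Qed.
Fact tstarZ (k : C) (x : tensor) : tstar (k *: x) = k^* *: tstar x.
Proof.
tens; rewrite tlift_star // !tlift_scale //; last exact: balanced_star.
rewrite tlift_star; last exact: balanced_scale.
by apply: eq_tlift => ? ?; rewrite starZ.
Qed.

HB.instance Definition _ := GRing.Lmodule_isLalgebra.Build C tensor tscaleAl.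
HB.instance Definition _ := GRing.Lalgebra_isAlgebra.Build C tensor tscaleAr.
HB.instance Definition _ := isStarAlgebra.Build C tensor
  tstarK tstarD tstarM tstarZ.

Lemma balanced_tpure : balanced tpure.
Proof.
split=> *; tens; rewrite ?tliftDE ?tlift_pure //;
  [by rewrite balDl|by rewrite balDr|by rewrite balZ].
Qed.

Lemma tpureM a b a' b' : tpure a b * tpure a' b' = tpure (a * a') (b * b').
Proof.
tens; rewrite tlift_mul // !tlift_pure //; last exact: balanced_tlift.
exact: balanced_mull.
Qed.
Lemma tpure1 : tpure 1 1 = 1. Proof. by []. Qed.
Lemma tpureZ (k : C) a b : k *: tpure a b = tpure (k *: a) b.
Proof.
by tens; rewrite tlift_scale // !tlift_pure //; exact: balanced_scale.
Qed.
Lemma star_tpure a b : star (tpure a b) = tpure (star a) (star b).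
Proof.
by tens; rewrite tlift_star // !tlift_pure //; exact: balanced_star.
Qed.

Lemma tensor_sumE (x : tensor) : x = \sum_(p <- repr x) tpure p.1 p.2.
Proof.
tens; rewrite (big_morph (tlift f) (id1 := 0) (op1 := +%R)); last first.
- exact: tlift0.
- by move=> y z; rewrite tliftDE.
by under [RHS]eq_bigr do rewrite tlift_pure //.
Qed.

Lemma tlift_uniq (W : zmodType) (f : A -> B -> W) (g : tensor -> W) :
  balanced f -> {morph g : x y / x + y} ->
  (forall a b, g (tpure a b) = f a b) -> g =1 tlift f.
Proof.
move=> hf gD gf x.
have g0 : g 0 = 0 by apply: (addrI (g 0)); rewrite -gD !addr0.
rewrite {1}(tensor_sumE x) (big_morph g gD g0) /tlift /teval.
by apply: eq_bigr.
Qed.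

End Tensor.

Arguments tensor {C} A B.

Notation "a '⊗' b" := (tpure a b) (at level 40, left associativity) : ring_scope.

Section TensorMap.
Variables (C : numClosedFieldType) (A B A' B' : starAlgType C).
Variables (f : {starmorphism A -> A'}) (g : {starmorphism B -> B'}).

Definition tensor_map : tensor A B -> tensor A' B' := tlift (fun a b => f a ⊗ g b).

Lemma tensor_map_balanced : balanced (fun a b => f a ⊗ g b).
Proof.
by have [hDl hDr hZ] := balanced_tpure A' B'; split=> *;
  rewrite ?raddfD ?hDl ?hDr // !linearZ hZ.
Qed.

Lemma tensor_map_pure a b : tensor_map (a ⊗ b) = f a ⊗ g b.
Proof. exact/tlift_pure/tensor_map_balanced. Qed.

End TensorMap.

Record magic (C : numClosedFieldType) (A : starAlgType C) (I : finType)
    (p : I -> I -> A) : Prop := Magic {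
  magic_star : forall i j, star (p i j) = p i j;
  magic_idem : forall i j, p i j * p i j = p i j;
  magic_row : forall i, \sum_j p i j = 1;
  magic_col : forall i, \sum_j p j i = 1;
  magic_orthr : forall i j k, j != k -> p i j * p i k = 0;
  magic_orthc : forall i j k, j != k -> p j i * p k i = 0 }.

(* [p] determines the comultiplication since it generates the algebra, so
   recording it as data amounts to requiring its existence. The size is the
   cardinal of the index type. *)
Record qpermgroup (C : numClosedFieldType) := QPermGroup {
  qindex : finType;
  qalg : starAlgType C;
  qgen : qindex -> qindex -> qalg;
  qgen_magic : magic qgen;
  qgen_generated : star_generated (fun a => exists i j, a = qgen i j);
  qcomul : {starmorphism qalg -> tensor qalg qalg};
  qcomulE : forall i j, qcomul (qgen i j) = \sum_k qgen i k ⊗ qgen k j }.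

Definition qiso (C : numClosedFieldType) (Gamma Lambda : qpermgroup C) : Prop :=
  exists2 phi : {starmorphism qalg Gamma -> qalg Lambda}, bijective phi &
    forall a, qcomul Lambda (phi a) = tensor_map phi phi (qcomul Gamma a).

Record sgraph := SGraph {
  vertex :> finType;
  edge : rel vertex;
  edge_sym : symmetric edge;
  edge_irr : irreflexive edge;
  vertex_gt0 : (0 < #|vertex|)%N }.

Definition acyclic (T : finType) (e : rel T) : Prop :=
  forall c : seq T, (2 < size c)%N -> ~ ucycle e c.

Definition tree_rel (T : finType) (e : rel T) : Prop :=
  (forall x y, connect e x y) /\ acyclic e.

(* The connected component of [x], as an induced subgraph. *)
Definition component (T : finType) (e : rel T) (x : T) : finType :=
  {y : T | connect e x y}.
Definition component_rel (T : finType) (e : rel T) (x : T)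
  : rel (component e x) := fun y z => e (val y) (val z).

Definition is_tree (G : sgraph) : Prop := tree_rel (@edge G).
Definition is_forest (G : sgraph) : Prop :=
  forall x : G, tree_rel (@component_rel G (@edge G) x).

Definition adj (C : numClosedFieldType) (G : sgraph) (x y : G) : C :=
  (edge x y)%:R.

Record graph_magic (C : numClosedFieldType) (G : sgraph) (A : starAlgType C)
    (u : G -> G -> A) : Prop := GraphMagic {
  graph_magic_magic :> magic u;
  graph_magic_adj : forall x y,
    \sum_z adj C z y *: u x z = \sum_z adj C x z *: u z y }.

Inductive sterm (C X : Type) : Type :=
| STgen of X
| STone
| STadd of sterm C X & sterm C X
| STscale of C & sterm C X
| STmul of sterm C X & sterm C X
| STstar of sterm C X.
Arguments STgen {C X}.
Arguments STone {C X}.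

Fixpoint seval (C : numClosedFieldType) (A : starAlgType C) (X : Type)
    (v : X -> A) (t : sterm C X) : A :=
  match t with
  | STgen x => v x
  | STone => 1
  | STadd t1 t2 => seval v t1 + seval v t2
  | STscale k t1 => k *: seval v t1
  | STmul t1 t2 => seval v t1 * seval v t2
  | STstar t1 => star (seval v t1)
  end.

Section Qu.
Variables (C : numClosedFieldType) (G : sgraph).

(* *-polynomials in the u_xy, identified when they agree in every *-algebra
   under every assignment satisfying the relations. The resulting quotient
   is the universal such algebra: see [qu_graph_magic], [qu_liftE] and
   [qu_lift_uniq]. *)
Definition qterm := sterm C (G * G).
HB.instance Definition _ := gen_eqMixin qterm.
HB.instance Definition _ := gen_choiceMixin qterm.

Definition qeval (A : starAlgType C) (v : G -> G -> A) : qterm -> A :=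
  seval (fun xy => v xy.1 xy.2).

Definition qequiv (s t : qterm) : Prop :=
  forall (A : starAlgType C) (v : G -> G -> A),
    graph_magic v -> qeval v s = qeval v t.

Definition qequivb (s t : qterm) : bool := `[< qequiv s t >].

Lemma qequivb_refl : reflexive qequivb.
Proof. by move=> s; apply/asboolP. Qed.
Lemma qequivb_sym : symmetric qequivb.
Proof.
by move=> s t; apply/asboolP/asboolP => h A v hv; rewrite (h A v hv).
Qed.
Lemma qequivb_trans : transitive qequivb.
Proof.
move=> t s r /asboolP h /asboolP h'; apply/asboolP => A v hv.
by rewrite (h A v hv) h'.
Qed.

Canonical qequiv_rel := EquivRel qequivb qequivb_refl qequivb_sym qequivb_trans.

Definition qualg := {eq_quot qequiv_rel}.
HB.instance Definition _ := Choice.on qualg.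

Definition qmk (t : qterm) : qualg := \pi_qualg t.

Lemma qmkP s t : qequiv s t <-> qmk s = qmk t.
Proof.
split; first by move=> h; apply/eqmodP/asboolP.
by move/eqmodP/asboolP.
Qed.

Lemma qmkK x : qmk (repr x) = x. Proof. exact: reprK. Qed.

Definition qev (A : starAlgType C) (v : G -> G -> A) (x : qualg) : A :=
  qeval v (repr x).

Lemma qev_mk (A : starAlgType C) (v : G -> G -> A) t :
  graph_magic v -> qev v (qmk t) = qeval v t.
Proof. by move=> hv; rewrite /qev; apply: (qmkP _ _).2 hv; rewrite qmkK. Qed.

Lemma qualg_eqP (x y : qualg) :
  (forall (A : starAlgType C) (v : G -> G -> A), graph_magic v -> qev v x = qev v y)
  <-> x = y.
Proof.
split=> [h|->//]; rewrite -(qmkK x) -(qmkK y); apply/qmkP => A v hv.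
exact: h.
Qed.

Definition qzero := qmk (STscale 0 STone).
Definition qone := qmk STone.
Definition qadd (x y : qualg) := qmk (STadd (repr x) (repr y)).
Definition qopp (x : qualg) := qmk (STscale (-1) (repr x)).
Definition qscale (k : C) (x : qualg) := qmk (STscale k (repr x)).
Definition qmul (x y : qualg) := qmk (STmul (repr x) (repr y)).
Definition qstar (x : qualg) := qmk (STstar (repr x)).
Definition qu (x y : G) : qualg := qmk (STgen (x, y)).

Section Qev.
Variables (A : starAlgType C) (v : G -> G -> A).
Hypothesis hv : graph_magic v.

Lemma qev0 : qev v qzero = 0. Proof. by rewrite qev_mk // /qeval /= scale0r. Qed.
Lemma qev1 : qev v qone = 1. Proof. by rewrite qev_mk. Qed.
Lemma qevD x y : qev v (qadd x y) = qev v x + qev v y.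
Proof. by rewrite qev_mk. Qed.
Lemma qevN x : qev v (qopp x) = - qev v x.
Proof. by rewrite qev_mk // /qeval /= scaleN1r. Qed.
Lemma qevZ k x : qev v (qscale k x) = k *: qev v x.
Proof. by rewrite qev_mk. Qed.
Lemma qevM x y : qev v (qmul x y) = qev v x * qev v y.
Proof. by rewrite qev_mk. Qed.
Lemma qev_star x : qev v (qstar x) = star (qev v x).
Proof. by rewrite qev_mk. Qed.
Lemma qev_qu x y : qev v (qu x y) = v x y.
Proof. by rewrite qev_mk. Qed.
End Qev.

Local Ltac quot := apply/qualg_eqP => A v hv.

Fact qaddA : associative qadd.
Proof. by move=> x y z; quot; rewrite !qevD // addrA. Qed.
Fact qaddC : commutative qadd.
Proof. by move=> x y; quot; rewrite !qevD // addrC. Qed.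
Fact qadd0 : left_id qzero qadd.
Proof. by move=> x; quot; rewrite qevD // qev0 // add0r. Qed.
Fact qaddN : left_inverse qzero qopp qadd.
Proof. by move=> x; quot; rewrite qevD // qevN // qev0 // addNr. Qed.

HB.instance Definition _ :=
  GRing.isZmodule.Build qualg qaddA qaddC qadd0 qaddN.

Fact qmulA : associative qmul.
Proof. by move=> x y z; quot; rewrite !qevM // mulrA. Qed.
Fact qmul1r : left_id qone qmul.
Proof. by move=> x; quot; rewrite qevM // qev1 // mul1r. Qed.
Fact qmulr1 : right_id qone qmul.
Proof. by move=> x; quot; rewrite qevM // qev1 // mulr1. Qed.
Fact qmulDl : left_distributive qmul qadd.
Proof. by move=> x y z; quot; rewrite !(qevM, qevD) // mulrDl. Qed.
Fact qmulDr : right_distributive qmul qadd.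
Proof. by move=> x y z; quot; rewrite !(qevM, qevD) // mulrDr. Qed.

Fact qone_neq0 : qone != 0.
Proof.
pose v (x y : G) : C^o := (x == y)%:R.
have sumv (f : G -> C) x : \sum_y f y * (x == y)%:R = f x.
  rewrite (bigD1 x) //= eqxx mulr1 big1 ?addr0 // => y yx.
  by rewrite eq_sym (negPf yx) mulr0.
have hv : graph_magic v.
  split; first split.
  - by move=> x y; exact: conjC_nat.
  - by move=> x y; rewrite /v -natrM mulnb andbb.
  - by move=> x; rewrite -[RHS](sumv (fun=> 1) x); apply: eq_bigr => y _; rewrite mul1r.
  - move=> x; rewrite -[RHS](sumv (fun=> 1) x); apply: eq_bigr => y _.
    by rewrite mul1r /v eq_sym.
  - move=> x y z yz; rewrite /v -natrM mulnb.
    by case: (eqVneq x y) => // ->; rewrite (negPf yz).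
  - move=> x y z yz; rewrite /v -natrM mulnb.
    by case: (eqVneq y x) => // <-; rewrite eq_sym (negPf yz).
  - move=> x y; rewrite [LHS](sumv (fun z => adj C z y) x).
    rewrite -[LHS](sumv (fun z => adj C x z) y).
    by apply: eq_bigr => z _; rewrite /v eq_sym.
apply/eqP => /(congr1 (qev v)); rewrite qev0 // qev1 // => /eqP.
by rewrite oner_eq0.
Qed.

HB.instance Definition _ :=
  GRing.Zmodule_isNzRing.Build qualg qmulA qmul1r qmulr1 qmulDl qmulDr qone_neq0.

Fact qscaleA k l (x : qualg) : qscale k (qscale l x) = qscale (k * l) x.
Proof. by quot; rewrite !qevZ // scalerA. Qed.
Fact qscale1 : left_id 1 qscale.
Proof. by move=> x; quot; rewrite qevZ // scale1r. Qed.
Fact qscaleDr : right_distributive qscale qadd.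
Proof. by move=> k x y; quot; rewrite !(qevZ, qevD) // scalerDr. Qed.
Fact qscaleDl (x : qualg) : {morph qscale^~ x : k l / k + l >-> qadd k l}.
Proof. by move=> k l; quot; rewrite !(qevZ, qevD) // scalerDl. Qed.

HB.instance Definition _ := GRing.Zmodule_isLmodule.Build C qualg
  qscaleA qscale1 qscaleDr qscaleDl.

Fact qscaleAl k (x y : qualg) : qscale k (qmul x y) = qmul (qscale k x) y.
Proof. by quot; rewrite !(qevZ, qevM) // scalerAl. Qed.
Fact qscaleAr k (x y : qualg) : qscale k (qmul x y) = qmul x (qscale k y).
Proof. by quot; rewrite !(qevZ, qevM) // scalerAr. Qed.
Fact qstarK : involutive qstar.
Proof. by move=> x; quot; rewrite !qev_star // starK. Qed.
Fact qstarD : {morph qstar : x y / qadd x y}.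
Proof. by move=> x y; quot; rewrite !(qev_star, qevD) // starD. Qed.
Fact qstarM x y : qstar (qmul x y) = qmul (qstar y) (qstar x).
Proof. by quot; rewrite !(qev_star, qevM) // starM. Qed.
Fact qstarZ (k : C) x : qstar (qscale k x) = qscale k^* (qstar x).
Proof. by quot; rewrite !(qev_star, qevZ) // starZ. Qed.

HB.instance Definition _ := GRing.Lmodule_isLalgebra.Build C qualg qscaleAl.
HB.instance Definition _ := GRing.Lalgebra_isAlgebra.Build C qualg qscaleAr.
HB.instance Definition _ := isStarAlgebra.Build C qualg
  qstarK qstarD qstarM qstarZ.

Section Lift.
Variables (A : starAlgType C) (v : G -> G -> A).

Definition qu_lift_fun of graph_magic v : qualg -> A := qev v.

Variable hv : graph_magic v.

Fact qu_lift_monoid : GRing.monoid_morphism (qu_lift_fun hv).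
Proof. by split=> [|x y]; [exact: qev1|exact: qevM]. Qed.
Fact qu_lift_nmod : GRing.nmod_morphism (qu_lift_fun hv).
Proof. by split=> [|x y]; [exact: qev0|exact: qevD]. Qed.
Fact qu_lift_scale : scalable (qu_lift_fun hv).
Proof. by move=> k x; exact: qevZ. Qed.
Fact qu_lift_star a : qu_lift_fun hv (star a) = star (qu_lift_fun hv a).
Proof. exact: qev_star. Qed.

HB.instance Definition _ :=
  GRing.isNmodMorphism.Build qualg A (qu_lift_fun hv) qu_lift_nmod.
HB.instance Definition _ :=
  GRing.isMonoidMorphism.Build qualg A (qu_lift_fun hv) qu_lift_monoid.
HB.instance Definition _ :=
  GRing.isScalable.Build C qualg A *:%R (qu_lift_fun hv) qu_lift_scale.
HB.instance Definition _ :=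
  isStarPreserving.Build C qualg A (qu_lift_fun hv) qu_lift_star.

Definition qu_lift : {starmorphism qualg -> A} := qu_lift_fun hv.

Lemma qu_liftE x y : qu_lift (qu x y) = v x y.
Proof. exact: qev_qu. Qed.

End Lift.

Lemma qualg_lift_inj (x y : qualg) :
  (forall (A : starAlgType C) (v : G -> G -> A) (hv : graph_magic v),
     qu_lift hv x = qu_lift hv y) -> x = y.
Proof. by move=> h; apply/qualg_eqP => A v hv; exact: (h A v hv). Qed.

Lemma qu_graph_magic : graph_magic qu.
Proof.
split; first split.
- move=> x y; apply: qualg_lift_inj => A v hv.
  by rewrite star_morph qu_liftE (magic_star hv).
- move=> x y; apply: qualg_lift_inj => A v hv.
  by rewrite rmorphM /= qu_liftE (magic_idem hv).
- move=> x; apply: qualg_lift_inj => A v hv.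
  rewrite rmorph1 raddf_sum -[RHS](magic_row hv x).
  by apply: eq_bigr => y _; exact: qu_liftE.
- move=> x; apply: qualg_lift_inj => A v hv.
  rewrite rmorph1 raddf_sum -[RHS](magic_col hv x).
  by apply: eq_bigr => y _; exact: qu_liftE.
- move=> x y z yz; apply: qualg_lift_inj => A v hv.
  by rewrite rmorphM raddf0 /= !qu_liftE (magic_orthr hv).
- move=> x y z yz; apply: qualg_lift_inj => A v hv.
  by rewrite rmorphM raddf0 /= !qu_liftE (magic_orthc hv).
- move=> x y; apply: qualg_lift_inj => A v hv.
  rewrite !raddf_sum /=.
  have vE x' y' k : qu_lift hv (k *: qu x' y') = k *: v x' y'.
    by rewrite linearZ /= -(qu_liftE hv).
  under eq_bigr do rewrite vE.
  under [RHS]eq_bigr do rewrite vE.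
  exact: graph_magic_adj hv x y.
Qed.

Lemma qu_generated : star_generated (fun a => exists x y, a = qu x y).
Proof.
move=> S [S1 SL SM Sstar] Squ a; rewrite -(qmkK a).
have S0 : S 0.
  by have := SL (-1) 1 1 S1 S1; rewrite scaleN1r addNr.
elim: (repr a) => [[x y]||s Ss t St|k s Ss|s Ss t St|s Ss].
- by apply: Squ; exists x, y.
- exact: S1.
- have := SL 1 _ _ Ss St; rewrite scale1r; congr S.
  by apply: qualg_lift_inj => A v hv; rewrite raddfD /= /qu_lift_fun !qev_mk.
- have := SL k _ _ Ss S0; rewrite addr0; congr S.
  by apply: qualg_lift_inj => A v hv; rewrite linearZ /= /qu_lift_fun !qev_mk.
- have := SM _ _ Ss St; congr S.
  by apply: qualg_lift_inj => A v hv; rewrite rmorphM /= /qu_lift_fun !qev_mk.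
- have := Sstar _ Ss; congr S.
  by apply: qualg_lift_inj => A v hv; rewrite star_morph /= /qu_lift_fun !qev_mk.
Qed.

Lemma qu_lift_uniq (A : starAlgType C) (v : G -> G -> A) (hv : graph_magic v)
    (f : {starmorphism qualg -> A}) :
  (forall x y, f (qu x y) = v x y) -> f =1 qu_lift hv.
Proof.
move=> fE; apply: (@qu_generated (fun a => f a = qu_lift hv a)).
  split=> [|k a b ha hb|a b ha hb|a ha].
  - by rewrite !rmorph1.
  - by rewrite !linearP /= [f a]ha [f b]hb.
  - by rewrite !rmorphM /= [f a]ha [f b]hb.
  - by rewrite !star_morph ha.
by move=> a [x [y ->]]; rewrite fE qu_liftE.
Qed.

Definition qu_delta (x y : G) : tensor qualg qualg := \sum_z qu x z ⊗ qu z y.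

Lemma qu_delta_magic : graph_magic qu_delta.
Proof.
have [um uA] := qu_graph_magic.
have bal := balanced_tpure qualg qualg.
have deltaM x y x' y' : qu_delta x y * qu_delta x' y' =
    \sum_z \sum_w (qu x z * qu x' w) ⊗ (qu z y * qu w y').
  rewrite /qu_delta mulr_suml; apply: eq_bigr => z _.
  by rewrite mulr_sumr; apply: eq_bigr => w _; rewrite tpureM.
split; first split.
- move=> x y; rewrite /qu_delta star_sum; apply: eq_bigr => z _.
  by rewrite star_tpure !(magic_star um).
- move=> x y; rewrite deltaM; apply: eq_bigr => z _.
  rewrite (bigD1 z) //= !(magic_idem um) big1 ?addr0 // => w wz.
  by rewrite (magic_orthr um) 1?eq_sym // (bal0l bal).
- move=> x; rewrite exchange_big /= -(tpure1 qualg qualg) -{1}(magic_row um x).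
  rewrite (bal_suml bal); apply: eq_bigr => z _.
  by rewrite -(bal_sumr bal) (magic_row um).
- move=> y; rewrite exchange_big /= -(tpure1 qualg qualg) -{2}(magic_col um y).
  rewrite (bal_sumr bal); apply: eq_bigr => z _.
  by rewrite -(bal_suml bal) (magic_col um).
- move=> x y y' yy'; rewrite deltaM big1 // => z _; rewrite big1 // => w _.
  have [<-|zw] := eqVneq z w; first by rewrite (magic_orthr um _ yy') (bal0r bal).
  by rewrite (magic_orthr um _ zw) (bal0l bal).
- move=> y x x' xx'; rewrite deltaM big1 // => z _; rewrite big1 // => w _.
  have [<-|zw] := eqVneq z w; first by rewrite (magic_orthc um _ xx') (bal0l bal).
  by rewrite (magic_orthc um _ zw) (bal0r bal).
- move=> x y; rewrite /qu_delta.
  under eq_bigr do rewrite scaler_sumr.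
  rewrite exchange_big /=.
  under eq_bigr => w _.
    under eq_bigr do rewrite tpureZ (balZ bal).
    rewrite -(bal_sumr bal) uA (bal_sumr bal).
    under eq_bigr do rewrite -(balZ bal).
    over.
  rewrite exchange_big /=.
  under eq_bigr => w _.
    rewrite -(bal_suml bal) uA (bal_suml bal).
    under eq_bigr do rewrite -tpureZ.
    over.
  rewrite exchange_big /=; apply: eq_bigr => w _.
  by rewrite scaler_sumr.
Qed.

Definition Qu : qpermgroup C :=
  @QPermGroup C G qualg qu qu_graph_magic qu_generated
    (qu_lift qu_delta_magic) (qu_liftE qu_delta_magic).

End Qu.

(* Main.v *)
From HB Require Import structures.
Require Import Defs.
From mathcomp Require Import all_boot all_order all_algebra.
From mathcomp Require Import complex boolp reals.

(* A magic unitary u commutes with a 0-1 matrix R if and only if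
   u_ij u_kl <> 0 implies R i k = R j l. The relations with this property are
   closed under boolean operations and under counting the common neighbours,
   so combinatorially defined relations are respected by Qu.

   Pruning the leaves of a forest F round after round leaves one vertex or one
   edge in each component K. Replace such an edge by a path through a new vertex
   c_K, attach c_K to the remaining vertex otherwise, give every vertex a leaf,
   and join all the c_K to a hub: this is a tree T. If F has at least two
   components, the hub is the only vertex of T which is neither a leaf nor
   adjacent to a leaf, so Qu(T) fixes it, hence preserves the set of the c_K, the
   leaves, the set of vertices of F and the edges of F; conversely the magic
   unitary on the vertices of F determines those on the c_K and on the leaves.
   So Qu(F) = Qu(T). *)

Set Implicit Arguments.
Unset Strict Implicit.
Unset Printing Implicit Defensive.

Import Order.TTheory GRing.Theory Num.Theory.
Local Open Scope ring_scope.

(** * Relations respected by a magic unitary *)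

Section QuantumInvariants.
Variables (C : numClosedFieldType) (A : starAlgType C) (I : finType).
Variable u : I -> I -> A.

(** [u] is block diagonal along the fibres of [f]; the target is arbitrary, so that heights and
    counts qualify. *)
Definition qinv1 (X : Type) (f : I -> X) : Prop :=
  forall i j, u i j != 0 -> f i = f j.

Definition qinv2 (X : Type) (f : I -> I -> X) : Prop :=
  forall i j k l, u i j * u k l != 0 -> f i k = f j l.

Lemma mul_neq0l (a b : A) : a * b != 0 -> a != 0.
Proof. by apply: contra_neq => ->; rewrite mul0r. Qed.

Lemma mul_neq0r (a b : A) : a * b != 0 -> b != 0.
Proof. by apply: contra_neq => ->; rewrite mulr0. Qed.

Lemma qinv2_mul0 (f : rel I) i j k l :
  qinv2 f -> f i k != f j l -> u i j * u k l = 0.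
Proof. by move=> fu; apply: contraNeq => /fu ->. Qed.

Lemma qinv1_0 (X : eqType) (f : I -> X) i j :
  qinv1 f -> f i != f j -> u i j = 0.
Proof. by move=> fu; apply: contraNeq => /fu ->. Qed.

Lemma qinv1_l (X : Type) (f : I -> X) : qinv1 f -> qinv2 (fun i _ => f i).
Proof. by move=> fu i j k l /mul_neq0l /fu. Qed.

Lemma qinv1_r (X : Type) (f : I -> X) : qinv1 f -> qinv2 (fun _ k => f k).
Proof. by move=> fu i j k l /mul_neq0r /fu. Qed.

Lemma qinv1_comp (X Y : Type) (g : X -> Y) (f : I -> X) :
  qinv1 f -> qinv1 (fun i => g (f i)).
Proof. by move=> fu i j /fu ->. Qed.

Lemma qinv1_op (X Y Z : Type) (op : X -> Y -> Z) f g :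
  qinv1 f -> qinv1 g -> qinv1 (fun i => op (f i) (g i)).
Proof. by move=> fu gu i j nz; rewrite (fu i j) ?(gu i j). Qed.

Lemma qinv2_comp (X Y : Type) (g : X -> Y) (f : I -> I -> X) :
  qinv2 f -> qinv2 (fun i k => g (f i k)).
Proof. by move=> fu i j k l /fu ->. Qed.

Lemma qinv2_op (X Y Z : Type) (op : X -> Y -> Z) f g :
  qinv2 f -> qinv2 g -> qinv2 (fun i k => op (f i k) (g i k)).
Proof. by move=> fu gu i j k l nz; rewrite (fu i j k l) ?(gu i j k l). Qed.

Lemma eq_qinv1 (X : Type) (f g : I -> X) : f =1 g -> qinv1 f -> qinv1 g.
Proof. by move=> fg fu i j /fu; rewrite !fg. Qed.

Hypothesis um : magic u.

Lemma qinv2_eq : qinv2 eq_op.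
Proof.
move=> i j k l; apply: contra_neq_eq => ne.
have [ik|ik] := eqVneq i k; have [jl|jl] := eqVneq j l.
- by rewrite ik jl !eqxx in ne.
- by rewrite ik (magic_orthr um).
- by rewrite jl (magic_orthc um).
- by rewrite (negPf ik) (negPf jl) in ne.
Qed.

(** Holds since [C] has characteristic 0; two counts can thus be compared through multiples of one
    nonzero element. *)
Lemma mulrn_neq0_inj (x : A) m n : x != 0 -> x *+ m = x *+ n -> m = n.
Proof.
move=> x0 /eqP; rewrite -!scaler_nat -subr_eq0 -scalerBl scaler_eq0 (negPf x0).
by rewrite orbF subr_eq0 eqr_nat => /eqP.
Qed.

(** Both multiples of [u i j * u k l] expand, by row sums on the left and column sums on the right,
    into terms [u i j * u m q * u k l]. A nonzero term forces [R i m = R j q] and [S m k = S q l],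
    so the two double sums agree. *)
Lemma qinv2_count (R S : rel I) : qinv2 R -> qinv2 S ->
  qinv2 (fun i k => #|[pred m | R i m && S m k]|).
Proof.
move=> Ru Su i j k l nz; apply: (mulrn_neq0_inj nz).
have rowE m : u i j * u k l = \sum_q u i j * u m q * u k l.
  by rewrite -mulr_suml -mulr_sumr (magic_row um) mulr1.
have colE q : u i j * u k l = \sum_m u i j * u m q * u k l.
  by rewrite -mulr_suml -mulr_sumr (magic_col um) mulr1.
rewrite -!sumr_const.
under eq_bigr => m _ do rewrite (rowE m).
under [RHS]eq_bigr => q _ do rewrite (colE q).
rewrite [RHS]exchange_big big_mkcond /=; apply: eq_bigr => m _.
rewrite [RHS]big_mkcond /=; case: ifP => h1; last first.
  rewrite big1 // => q _; case: ifP => // h2; apply: contraFeq h1 => nz2.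
  have nzR := mul_neq0l nz2; have nzS := nz2; rewrite -mulrA in nzS.
  by move: h2; rewrite !inE (Ru _ _ _ _ nzR) (Su _ _ _ _ (mul_neq0r nzS)).
apply: eq_bigr => q _; case: ifPn => // h2; apply: contraNeq h2 => nz2.
have nzR := mul_neq0l nz2; have nzS := nz2; rewrite -mulrA in nzS.
by move: h1; rewrite !inE (Ru _ _ _ _ nzR) (Su _ _ _ _ (mul_neq0r nzS)).
Qed.

(** Entries are idempotent, so [u i j] is itself a product of two entries. *)
Lemma qinv2_diag (X : Type) (f : I -> I -> X) : qinv2 f -> qinv1 (fun i => f i i).
Proof. by move=> fu i j; rewrite -(magic_idem um) => /fu. Qed.

Lemma qinv1_count (R : rel I) : qinv2 R -> qinv1 (fun i => #|[pred m | R i m]|).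
Proof.
move=> Ru; have Tu : qinv2 (fun _ _ => true) by [].
apply: eq_qinv1 (qinv2_diag (qinv2_count Ru Tu)) => i.
by apply: eq_card => m; rewrite !inE andbT.
Qed.

Lemma qinv1_card_nbr (R : rel I) (P : pred I) : qinv2 R -> qinv1 P ->
  qinv1 (fun i => #|[pred m | R i m && P m]|).
Proof.
by move=> Ru Pu; apply: qinv1_count; apply: (qinv2_op andb) => //; apply: qinv1_r.
Qed.

(** Inserting the row sums at [x] and at [s] turns both sides into the sum of the [u s t * u x y]
    with [R t y]. Row [s] is thus determined by row [x]; this recovers centres from vertices and
    leaves from the core. *)
Lemma magic_functional (R : rel I) s t x : qinv2 R ->
    (forall t1 t2 y, R t1 y -> R t2 y -> t1 = t2) -> R s x ->
  u s t = \sum_(y | R t y) u x y.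
Proof.
move=> Ru Rfun Rsx.
rewrite -[u s t]mulr1 -(magic_row um x) mulr_sumr (bigID (R t)) /=.
rewrite [X in _ + X]big1 ?addr0 => [|y /negPf nR]; last first.
  by apply: (qinv2_mul0 Ru); rewrite Rsx nR.
apply: eq_bigr => y Rty; rewrite -[RHS]mul1r -(magic_row um s) mulr_suml.
rewrite (bigD1 t) //= big1 ?addr0 // => t' t't; apply: (qinv2_mul0 Ru).
by rewrite Rsx; apply: contra_neq t't => /esym Rt'y; apply: Rfun Rty.
Qed.

End QuantumInvariants.

(** * Commutation with an adjacency matrix *)

Section GraphMagic.
Variables (C : numClosedFieldType) (G : sgraph) (A : starAlgType C).
Variable u : G -> G -> A.

Lemma sum_adjl (f : G -> A) y :
  \sum_z adj C z y *: f z = \sum_(z | edge z y) f z.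
Proof.
rewrite [RHS]big_mkcond; apply: eq_bigr => z _; rewrite /adj.
by case: edge; rewrite ?scale1r ?scale0r.
Qed.

Lemma sum_adjr (f : G -> A) x :
  \sum_z adj C x z *: f z = \sum_(z | edge x z) f z.
Proof.
rewrite [RHS]big_mkcond; apply: eq_bigr => z _; rewrite /adj.
by case: edge; rewrite ?scale1r ?scale0r.
Qed.

(** Multiply the commutation relation at [(i, l)] by [u i j] on the left and [u k l] on the right:
    orthogonality leaves one term on each side, with coefficients [edge j l] and [edge i k]. *)
Lemma graph_magic_qinv2 : graph_magic u -> qinv2 u (@edge G).
Proof.
move=> gm i j k l; apply: contra_neq_eq => ne.
have := graph_magic_adj gm i l; rewrite sum_adjl sum_adjr.
move=> /(congr1 (fun a => u i j * a * u k l)).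
rewrite !mulr_sumr !mulr_suml (big_mkcond (fun z => edge z l)).
rewrite [RHS]big_mkcond (bigD1 j) //= (magic_idem gm) big1 ?addr0; last first.
  by move=> z zj; rewrite (magic_orthr gm) 1?eq_sym // mul0r if_same.
rewrite [RHS](bigD1 k) //= -mulrA (magic_idem gm) big1 ?addr0; last first.
  by move=> z zk; rewrite -mulrA (magic_orthc gm) // mulr0 if_same.
by move: ne; case: edge; case: edge.
Qed.

(** Both sides equal the sum of the [u x z * u t y] over the neighbours [z] of [y] and [t] of
    [x]. *)
Lemma qinv2_graph_magic : magic u -> qinv2 u (@edge G) -> graph_magic u.
Proof.
move=> um eu; split=> // x y; rewrite sum_adjl sum_adjr.
transitivity (\sum_(z | edge z y) \sum_(t | edge x t) u x z * u t y).
  apply: eq_bigr => z zy; rewrite -[LHS]mulr1 -(magic_col um y) mulr_sumr.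
  rewrite [RHS]big_mkcond; apply: eq_bigr => t _; case: ifPn => // /negPf xt.
  by apply: (qinv2_mul0 eu); rewrite xt zy.
rewrite exchange_big /=; apply: eq_bigr => t xt.
rewrite -[RHS]mul1r -(magic_row um x) mulr_suml big_mkcond.
apply: eq_bigr => z _; case: ifPn => // /negPf zy.
by apply/esym/(qinv2_mul0 eu); rewrite xt zy.
Qed.

End GraphMagic.

Local Open Scope nat_scope.

(** * Pruning forests *)

Section Acyclic.
Variables (T : finType) (e : rel T).
Hypotheses (e_sym : symmetric e) (e_irr : irreflexive e).

(** Otherwise every vertex of [D] has two neighbours in [D], and a simple path in [D] can be
    prolonged forever, since meeting itself would close a cycle. *)
Lemma acyclic_has_leaf (D : {set T}) x : acyclic e -> x \in D ->
  exists2 y, y \in D & #|[pred z | e y z && (z \in D)]| <= 1.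
Proof.
move=> ac xD; apply: contrapT => nleaf.
have next y z : y \in D -> exists t, [/\ t \in D, e y t & t != z].
  move=> yD; have /card_gt1P[t1 [t2 [/andP[et1 t1D] /andP[et2 t2D] t12]]] :
      1 < #|[pred z | e y z && (z \in D)]|.
    by rewrite ltnNge; apply/negP => le1; apply: nleaf; exists y.
  have [t1z|] := eqVneq t1 z; last by exists t1.
  by exists t2; split; rewrite // eq_sym -t1z.
suff /(_ #|T|)[y [p [sp _ /card_uniqP yp _]]] n : exists y p,
    [/\ size p = n, path e y p, uniq (y :: p) & {subset y :: p <= D}].
  by have := max_card (mem (y :: p)); rewrite yp /= sp ltnn.
elim: n => [|n [y [p [sp ep up pD]]]].
  by exists x, [::]; split=> // t; rewrite inE => /eqP->.
(* The path grows at its head [y], avoiding the previous vertex; for empty [p] the default is [y]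
   itself. *)
have [t [tD yt tp]] := next y (head y p) (pD y (mem_head _ _)).
have [tyin|tnin] := boolP (t \in y :: p); last first.
  exists t, (y :: p); split=> //=.
  - by rewrite sp.
  - by rewrite e_sym yt.
  - by rewrite tnin.
  - by move=> s; rewrite inE => /predU1P[->|/pD].
have ty : t != y by apply: contraTneq yt => ->; rewrite e_irr.
have {ty tyin} : t \in p by rewrite inE (negPf ty) in tyin.
move=> /[dup] tp' /(nth_index y) nt.
have lt_ip : index t p < size p by rewrite index_mem.
have i_gt0 : 0 < index t p.
  by rewrite lt0n; apply: contraNneq tp => i0; rewrite -nt i0 nth0.
(* [t] lies in [p] but is not its head, so this segment has at least three vertices. *)
case: (ac (y :: take (index t p).+1 p)).
  by rewrite /= size_takel.
apply/andP; split; last first.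
  move: up; rewrite -{1}(cat_take_drop (index t p).+1 p) -cat_cons cat_uniq.
  by case/andP.
rewrite /cycle rcons_path; apply/andP; split.
  by move: ep; rewrite -{1}(cat_take_drop (index t p).+1 p) cat_path => /andP[].
by rewrite (take_nth y) // last_rcons nt e_sym.
Qed.

(* Deletes the leaves, except those attached to another leaf. *)
Definition prune (S : {set T}) : {set T} :=
  [set x in S | (1 < #|[pred y | e x y && (y \in S)]|) ||
     (#|[pred y | e x y &&
        ((1 < #|[pred z | e y z && (z \in S)]|) && (y \in S))]| == 0)].

(** Let [D] be the set of vertices with at least two neighbours in [S]. By stability all neighbours
    in [S] of a vertex of [D] are again in [D], so a nonempty [D] contradicts [acyclic_has_leaf]. *)
Lemma prune_fixed (S : {set T}) x : acyclic e -> prune S = S -> x \in S ->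
  #|[pred y | e x y && (y \in S)]| <= 1.
Proof.
move=> ac fS xS; rewrite leqNgt; apply/negP => x2.
pose D := [set y in S | 1 < #|[pred z | e y z && (z \in S)]|].
have xD : x \in D by rewrite inE xS.
have [y yD] := acyclic_has_leaf ac xD.
have [yS y2] : y \in S /\ 1 < #|[pred z | e y z && (z \in S)]|.
  by move: yD; rewrite inE => /andP[].
apply/negP; rewrite -ltnNge (leq_trans y2) //; apply/subset_leq_card.
apply/subsetP => z; rewrite !inE => /andP[yz zS]; rewrite yz zS /=.
move: (zS); rewrite -{1}fS inE zS /= => /orP[//|/eqP/card0_eq/(_ y)].
by rewrite !inE e_sym yz y2 yS.
Qed.

End Acyclic.

(** The height is the number of rounds of pruning survived until the set is stable. Each round is
    defined by counting neighbours, so one [h] serves all magic unitaries. *)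
Lemma pruning_height (G : sgraph) (S : {set G}) : acyclic (@edge G) ->
  exists h : G -> nat,
    (forall x, x \in S ->
       #|[pred y | edge x y && ((h x <= h y) && (y \in S))]| <= 1) /\
    (forall (C : numClosedFieldType) (A : starAlgType C) (u : G -> G -> A),
       graph_magic u -> qinv1 u (fun x => x \in S) -> qinv1 u h).
Proof.
move=> ac; have [n] := ubnP #|S|; elim: n S => // n IHn S; rewrite ltnS => leSn.
have [fS|nfS] := eqVneq (prune (@edge G) S) S.
  exists (fun=> 0); split=> // x xS.
  by have := prune_fixed (@edge_sym G) (@edge_irr G) ac fS xS.
have sub : prune (@edge G) S \subset S by apply/subsetP => x; rewrite inE => /andP[].
have [|h [h1 hinv]] := IHn (prune (@edge G) S).
  apply: leq_trans leSn; apply: proper_card.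
  by rewrite properEneq nfS.
exists (fun x => if x \in prune (@edge G) S then (h x).+1 else 0); split=> [x xS|].
  (* Neighbours at least as high as a survivor survive too; a deleted vertex has at most one
     neighbour in [S] altogether. *)
  case: ifP => xp.
    apply: leq_trans (h1 x xp); apply/subset_leq_card/subsetP => y.
    rewrite !inE; case: ifP => _; last by rewrite ltn0 andbF.
    by rewrite ltnS => /and3P[-> ->].
  rewrite leqNgt; apply: contraFN xp => x2; rewrite inE xS.
  by rewrite (leq_trans x2).
move=> C A u gm Su; have eu := graph_magic_qinv2 gm.
have pu : qinv1 u (fun x => x \in prune (@edge G) S).
  have du : qinv1 u (fun x => 1 < #|[pred y | edge x y && (y \in S)]|).
    exact: (qinv1_comp (leq 2)) (qinv1_card_nbr gm eu Su).
  pose b1 := (qinv1_op andb du Su).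
  have := qinv1_op andb Su (qinv1_op orb du
    (qinv1_comp (eq_op^~ 0) (qinv1_card_nbr gm eu b1))).
  by apply: eq_qinv1 => x; rewrite inE.
by move=> i j nz; rewrite (pu i j nz) (hinv C A u gm pu i j nz).
Qed.

(** A vertex of minimal height on a cycle has two cycle neighbours at least as high; they would
    coincide, which length at least three excludes. *)
Lemma acyclic_height (T : finType) (e : rel T) (H : T -> nat) : symmetric e ->
    (forall x y z, e x y -> e x z -> H x <= H y -> H x <= H z -> y = z) ->
  acyclic e.
Proof.
move=> e_sym Huniq [//|x0 c] sc /andP[ce uc].
have [x xc xmin] := arg_minnP H (mem_head x0 c : mem (x0 :: c) x0).
have [i p rp] := rot_to xc.
move: sc ce uc; rewrite -(size_rot i) -(rot_cycle i) -(rot_uniq i) rp.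
have {}xmin y : y \in p -> H x <= H y.
  move=> yp; apply: xmin; suff : y \in rot i (x0 :: c) by rewrite mem_rot.
  by rewrite rp inE yp orbT.
case: p xmin {rp} => [|y [|z q]] // xmin _.
rewrite /cycle rcons_path /= => /andP[/and3P[xy _ _] lx] /and3P[_ yzq _].
have lzq := mem_last z q; case/negP: yzq.
rewrite (Huniq x y (last z q)) // ?xmin ?inE ?eqxx //; first by rewrite e_sym.
by rewrite -in_cons lzq orbT.
Qed.

Section Components.
Variable G : sgraph.

Lemma forest_acyclic : is_forest G -> acyclic (@edge G).
Proof.
move=> fG [//|x c] sc /andP[ce uc]; have [_ ac] := fG x.
have cx : all (connect (@edge G) x) (x :: c).
  apply/allP => y yc; apply: (path_connect (p := c)) => //.
  by move: ce; rewrite /cycle rcons_path => /andP[].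
pose s : seq (component (@edge G) x) := pmap insub (x :: c).
have vs : map val s = x :: c.
  rewrite pmap_filter; last exact: insubK.
  by apply/all_filterP; rewrite (eq_all (isSome_insub _)).
apply: (ac s); first by rewrite -(size_map val) vs.
by rewrite /ucycle -(map_inj_uniq val_inj) vs uc andbT; rewrite -vs cycle_map in ce.
Qed.

Lemma tree_forest : is_tree G -> is_forest G.
Proof.
case=> cG aG x; split=> [[y xy] [z xz]|c sc /andP[ce uc]]; last first.
  apply: (aG (map val c)); first by rewrite size_map.
  by rewrite /ucycle (map_inj_uniq val_inj) uc cycle_map andbT.
have /connectP[p yp zE] := cG y z.
elim: p y xy yp zE => [|t p IHp] y xy /=.
  move=> _ zy; have -> : exist _ y xy = exist _ z xz :> component (@edge G) x.
    exact/val_inj/esym.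
  exact: connect0.
move=> /andP[yt tp] zE.
have xt : connect (@edge G) x t := connect_trans xy (connect1 yt).
by apply: connect_trans (IHp t xt tp zE); apply: connect1.
Qed.

End Components.

Lemma acyclic_is_tree (G : sgraph) x0 : acyclic (@edge G) ->
  (forall x, connect (@edge G) x x0) -> is_tree G.
Proof.
move=> ac c0; split=> // x y.
have csym := sym_connect_sym (@edge_sym G).
by apply: connect_trans (c0 x) _; rewrite csym.
Qed.

(** * Joining the components of a forest into a tree *)

Section Joining.
Variables (G : sgraph) (h : G -> nat).

(* When every vertex has at most one neighbour of at least its height, a
   component has one or two top vertices, which are then siblings. *)
Definition sibling (v w : G) := (v == w) || edge v w && (h v == h w).

Definition top (v : G) := [forall w : G, edge v w ==> (h w <= h v)].

(** Once [sibling] is an equivalence, the choice depends only on the class. *)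
Definition sibling_repr (v : G) : G := choose (sibling v) v.

(* One element for each component, playing the role of the middle of its center. *)
Definition centre : finType := {v : G | top v && (sibling_repr v == v)}.

Definition core : finType := (G + centre)%type.

(** Edges between vertices of equal height are dropped; a centre links their ends instead. *)
Definition core_edge (x y : core) : bool :=
  match x, y with
  | inl v, inl w => edge v w && (h v != h w)
  | inl v, inr k => sibling v (val k)
  | inr k, inl v => sibling v (val k)
  | inr _, inr _ => false
  end.

(* Two copies of [core], the second made of leaves, and a hub adjacent to all
   centres. The hub is the only vertex which is neither a leaf nor adjacent to
   a leaf, hence it is preserved by quantum automorphisms. *)
Definition join_vertex : finType := ((core + core) + unit)%type.

Definition join_edge (s t : join_vertex) : bool :=
  match s, t with
  | inl (inl x), inl (inl y) => core_edge x y
  | inl (inl x), inl (inr y) => x == y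
  | inl (inr x), inl (inl y) => x == y
  | inl (inl (inr _)), inr _ => true
  | inr _, inl (inl (inr _)) => true
  | _, _ => false
  end.

Lemma join_edge_sym : symmetric join_edge.
Proof.
move=> [[[v|k]|x]|[]] [[[w|l]|y]|[]] //=; rewrite 1?eq_sym //.
by rewrite edge_sym [h w == _]eq_sym.
Qed.

Lemma join_edge_irr : irreflexive join_edge.
Proof. by move=> [[[v|k]|x]|[]] //=; rewrite edge_irr. Qed.

Lemma join_vertex_gt0 : 0 < #|{: join_vertex}|.
Proof. by apply/card_gt0P; exists (inr tt). Qed.

Definition join : sgraph := SGraph join_edge_sym join_edge_irr join_vertex_gt0.

Definition hub : join := inr tt.
Definition in_core (x : core) : join := inl (inl x).
Definition in_leaf (x : core) : join := inl (inr x).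

Lemma edge_core_leaf x y : edge (in_core x) (in_leaf y) = (x == y).
Proof. by case: x. Qed.

Lemma sibling_refl : reflexive sibling.
Proof. by move=> v; rewrite /sibling eqxx. Qed.

Lemma sibling_sym : symmetric sibling.
Proof.
by move=> v w; rewrite /sibling eq_sym edge_sym [h v == _]eq_sym.
Qed.

Hypothesis h_uniq : forall v w1 w2 : G,
  edge v w1 -> edge v w2 -> h v <= h w1 -> h v <= h w2 -> w1 = w2.

Lemma sibling_trans : transitive sibling.
Proof.
move=> w v x /predU1P[->//|/andP[vw hvw]] /predU1P[<-|/andP[wx hwx]].
  by rewrite /sibling vw hvw orbT.
rewrite edge_sym in vw.
by rewrite (h_uniq vw wx) ?sibling_refl // -?(eqP hwx) ?(eqP hvw).
Qed.

Lemma edge_top (v w : G) : edge v w -> h v = h w -> top v.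
Proof.
move=> vw hvw; apply/forallP => z; apply/implyP => vz.
rewrite leqNgt; apply/negP => hvz.
by move: (hvz); rewrite (h_uniq vz vw) ?hvw ?ltnn // -?hvw // ltnW.
Qed.

Lemma sibling_top (v w : G) : sibling v w -> top v = top w.
Proof.
move=> /predU1P[->//|/andP[vw /eqP hvw]].
by rewrite (edge_top vw hvw) (edge_top (w := v)) // edge_sym.
Qed.

(** Separates the edges kept in the core from those subdivided by a centre. *)
Lemma edge_split (v w : G) : edge v w =
  edge v w && (h v != h w) || (v != w) && (top v && sibling v w).
Proof.
rewrite /sibling; have [<-|vw] /= := eqVneq v w; first by rewrite edge_irr.
have [e /=|//] := boolP (edge v w); last by rewrite /= andbF.
by case: eqVneq => //= hvw; rewrite (edge_top e hvw).
Qed.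

Lemma sibling_reprE (v w : G) : sibling v w -> sibling_repr v = sibling_repr w.
Proof.
move=> vw; have eqs : sibling v =1 sibling w.
  move=> x; apply/idP/idP; apply: sibling_trans => //.
  by rewrite sibling_sym.
rewrite /sibling_repr (eq_choose eqs); apply: choose_id; last exact: sibling_refl.
by rewrite sibling_sym.
Qed.

Lemma sibling_reprP v : sibling v (sibling_repr v).
Proof. exact/chooseP/sibling_refl. Qed.

Lemma centre_top (k : centre) : top (val k).
Proof. by case/andP: (valP k). Qed.

Lemma sibling_centre v : top v -> exists k : centre, sibling v (val k).
Proof.
move=> tv; have vr := sibling_reprP v.
have rP : top (sibling_repr v) && (sibling_repr (sibling_repr v) == sibling_repr v).
  by rewrite -(sibling_top vr) tv -(sibling_reprE vr) eqxx.
by exists (Sub (sibling_repr v) rP).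
Qed.

Lemma centre_uniq v (k l : centre) :
  sibling v (val k) -> sibling v (val l) -> k = l.
Proof.
move=> vk vl; apply: val_inj.
have [/andP[_ /eqP<-] /andP[_ /eqP<-]] := (valP k, valP l).
by rewrite -(sibling_reprE vk) -(sibling_reprE vl).
Qed.

Lemma join_acyclic : acyclic (@edge join).
Proof.
pose N := \max_v h v; have hN v : h v <= N by exact: leq_bigmax.
(* Leaves lie lowest, centres above all vertices of [G], the hub highest; each vertex then has at
   most one neighbour of at least its height. *)
pose H (s : join) := match s with
  | inl (inl (inl v)) => (h v).+1
  | inl (inl (inr _)) => N.+2
  | inl (inr _) => 0
  | inr _ => N.+3
  end.
have no_up v w (k : centre) : sibling v (val k) -> edge v w -> h v != h w ->
    h v <= h w -> False.
  move=> vk vw ne le; have := centre_top k; rewrite -(sibling_top vk).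
  by move=> /forallP/(_ w); rewrite vw /= leqNgt ltn_neqAle ne le.
apply: (@acyclic_height _ _ H (@edge_sym join)).
move=> [[[v|k]|x]|[]] [[[w|l]|y]|[]] [[[w'|l']|y']|[]] //=; rewrite ?ltnS ?ltnn //.
- move=> /andP[e1 _] /andP[e2 _] h1 h2.
  by rewrite (h_uniq e1 e2).
- by move=> /andP[e1 n1] vl h1 _; case: (no_up _ _ _ vl e1 n1 h1).
- by move=> vl /andP[e1 n1] _ h1; case: (no_up _ _ _ vl e1 n1 h1).
- by move=> vl vl' _ _; rewrite (centre_uniq vl vl').
- by move=> _ _; rewrite ltnNge hN.
- by move=> _ _; rewrite ltnNge hN.
- by move=> _ _ _; rewrite ltnNge hN.
- by move=> /eqP<- /eqP<-.
- by move=> /eqP<- /eqP<-.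
- by move=> /eqP<- /eqP<-.
- by move=> /eqP<- /eqP<-.
Qed.

Lemma connect_top (v : G) : exists2 w, connect (@edge G) v w & top w.
Proof.
have [n] := ubnP (\max_w h w - h v); elim: n v => // n IHn v; rewrite ltnS => le_n.
have [tv|] := boolP (top v); first by exists v.
case/forallPn => w; rewrite negb_imply -ltnNge => /andP[vw hvw].
have [|x wx tx] := IHn w.
  apply: leq_trans le_n; apply: ltn_sub2l => //.
  by apply: leq_trans hvw _; apply: leq_bigmax.
by exists x => //; apply: connect_trans (connect1 vw) wx.
Qed.

Lemma join_connect s : connect (@edge join) s hub.
Proof.
have ck (k : centre) : connect (@edge join) (in_core (inr k)) hub by exact: connect1.
have cv v : connect (@edge join) (in_core (inl v)) hub.
  have [n] := ubnP (\max_w h w - h v); elim: n v => // n IHn v; rewrite ltnS => le_n.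
  have [/sibling_centre[k vk]|] := boolP (top v).
    by apply: connect_trans (ck k); apply: connect1.
  case/forallPn => w; rewrite negb_imply -ltnNge => /andP[vw hvw].
  apply: (connect_trans (y := in_core (inl w))).
    by apply: connect1; rewrite /= vw neq_ltn hvw.
  apply: IHn; apply: leq_trans le_n; apply: ltn_sub2l => //.
  by apply: leq_trans hvw _; apply: leq_bigmax.
have cx x : connect (@edge join) (in_core x) hub by case: x.
case: s => [[x|x]|[]] //; first exact: cx.
by apply: connect_trans (cx x); apply: connect1 => /=.
Qed.

Lemma join_is_tree : is_tree join.
Proof. exact: acyclic_is_tree join_acyclic join_connect. Qed.

(** Covers the case where the hub would have a single neighbour and so be a leaf itself; every
    vertex is then connected to the only centre. *)
Lemma one_centre_is_tree : acyclic (@edge G) -> (forall k l : centre, k = l) ->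
  is_tree G.
Proof.
move=> ac one; have [x0 _] := card_gt0P (vertex_gt0 G).
have [w0 _ /sibling_centre[k0 _]] := connect_top x0.
apply: (acyclic_is_tree (x0 := val k0)) => // x.
have [w xw /sibling_centre[k wk]] := connect_top x.
apply: connect_trans xw _; rewrite -(one k k0).
by case/predU1P: wk => [->|/andP[/connect1]].
Qed.

End Joining.

Local Close Scope nat_scope.

(** * Magic unitaries of the joined tree *)

Section DirectSum.
Variables (C : numClosedFieldType) (A : starAlgType C) (I J : finType).
Variables (u : I -> I -> A) (w : J -> J -> A).

Definition dsum (s t : I + J) : A :=
  match s, t with
  | inl i, inl j => u i j
  | inr i, inr j => w i j
  | _, _ => 0
  end.

Lemma dsum_magic : magic u -> magic w -> magic dsum.
Proof.
move=> um wm; split.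
- by move=> [i|i] [j|j] /=; rewrite ?star0 ?(magic_star um) ?(magic_star wm).
- by move=> [i|i] [j|j] /=; rewrite ?mul0r ?(magic_idem um) ?(magic_idem wm).
- move=> [i|i]; rewrite big_sumType /=.
    by rewrite (magic_row um) big1 ?addr0.
  by rewrite (magic_row wm) big1 ?add0r.
- move=> [i|i]; rewrite big_sumType /=.
    by rewrite (magic_col um) big1 ?addr0.
  by rewrite (magic_col wm) big1 ?add0r.
- move=> [i|i] [j|j] [k|k] //= jk; rewrite ?(mul0r, mulr0) //.
    by rewrite (magic_orthr um).
  by rewrite (magic_orthr wm).
- move=> [i|i] [j|j] [k|k] //= jk; rewrite ?(mul0r, mulr0) //.
    by rewrite (magic_orthc um).
  by rewrite (magic_orthc wm).
Qed.

End DirectSum.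

Lemma magic_unit (C : numClosedFieldType) (A : starAlgType C) :
  magic (fun _ _ : unit => 1 : A).
Proof.
split=> [_ _|_ _|_|_|_ [] []|_ [] []] //; rewrite ?star1 ?mulr1 //.
  by rewrite big_const card_unit /= addr0.
by rewrite big_const card_unit /= addr0.
Qed.

Section BlockSum.
Variables (C : numClosedFieldType) (A : starAlgType C) (I : finType).
Variables (u : I -> I -> A) (E : rel I).
Hypotheses (um : magic u) (Eu : qinv2 u E).
Hypothesis E_sym : symmetric E.

(* Both sides equal their product. *)
Lemma block_sumC v w : \sum_(y | E y w) u v y = \sum_(x | E x v) u x w.
Proof.
transitivity ((\sum_(y | E y w) u v y) * \sum_(x | E x v) u x w).
  rewrite mulr_suml; apply: eq_bigr => y yw.
  rewrite -[LHS]mulr1 -(magic_col um w) !mulr_sumr [RHS]big_mkcond.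
  apply: eq_bigr => x _; case: ifPn => // /negPf xv; apply: (qinv2_mul0 Eu).
  by rewrite yw E_sym xv.
rewrite mulr_sumr; apply: eq_bigr => x xv.
rewrite -[RHS]mul1r -(magic_row um v) !mulr_suml [LHS]big_mkcond.
apply: eq_bigr => y _; case: ifPn => // /negPf yw.
by apply/esym/(qinv2_mul0 Eu); rewrite yw E_sym xv.
Qed.

End BlockSum.

Section JoinMagic.
Variables (G : sgraph) (h : G -> nat).
Hypothesis h_uniq : forall v w1 w2 : G, edge v w1 -> edge v w2 ->
  (h v <= h w1)%N -> (h v <= h w2)%N -> w1 = w2.
Variables (C : numClosedFieldType) (A : starAlgType C).

Section Lift.
Variable u : G -> G -> A.
Hypotheses (gm : graph_magic u) (hu : qinv1 u h).

Let eu := graph_magic_qinv2 gm.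

Lemma qinv2_sibling : qinv2 u (sibling h).
Proof.
apply: (qinv2_op orb (qinv2_eq gm)); apply: (qinv2_op andb eu).
exact: (qinv2_op eq_op (qinv1_l hu) (qinv1_r hu)).
Qed.

(** Tops are the vertices whose number of strictly higher neighbours is zero. *)
Lemma qinv1_top : qinv1 u (top h).
Proof.
have Ru := qinv2_op andb eu (qinv2_op ltn (qinv1_l hu) (qinv1_r hu)).
apply: eq_qinv1 (qinv1_comp (eq_op^~ 0%N) (qinv1_count gm Ru)) => v.
apply/eqP/forallP => [/card0_eq h0 w|h0].
  apply/implyP => vw; rewrite leqNgt; apply/negP => hvw.
  by have := h0 w; rewrite !inE vw => /negP; apply.
apply: eq_card0 => w; rewrite !inE; apply/negP => /andP[vw] /=.
by rewrite ltnNge; have := h0 w; rewrite vw /= => ->.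
Qed.

(** The quotient of [u] on classes of sibling tops, read in the row of the representative;
    [block_sumC] gives the same value by columns. *)
Definition centre_mx (k l : centre h) : A :=
  \sum_(y | sibling h y (val l)) u (val k) y.

Lemma big_centre (F : G -> A) : (forall v, ~~ top h v -> F v = 0) ->
  \sum_(k : centre h) \sum_(v | sibling h v (val k)) F v = \sum_v F v.
Proof.
move=> F0; rewrite (exchange_big_dep xpredT) //=; apply: eq_bigr => v _.
have [tv|/F0->] := boolP (top h v); last by rewrite big1.
have [k vk] := sibling_centre h_uniq tv.
rewrite (bigD1 k) //= big1 ?addr0 // => l /andP[vl /eqP[]].
exact: centre_uniq vl vk.
Qed.

Lemma centre_magic : magic centre_mx.
Proof.
have tT (k : centre h) : top h (val k) := centre_top k.
split=> [k l|k l|k|l|k l l' ll'|l k k' kk']; rewrite /centre_mx.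
- rewrite big_mkcond star_sum; apply: eq_bigr => y _.
  by case: ifP; rewrite ?star0 ?(magic_star gm).
- rewrite mulr_suml; apply: eq_bigr => y yl; rewrite mulr_sumr (bigD1 y) //=.
  rewrite (magic_idem gm) big1 ?addr0 // => y' /andP[_ y'y].
  by rewrite (magic_orthr gm) // eq_sym.
- rewrite big_centre ?(magic_row gm) // => v /negPf ntv.
  by apply: (qinv1_0 qinv1_top); rewrite ntv tT.
- under eq_bigr => k _ do rewrite
    (block_sumC gm qinv2_sibling (@sibling_sym G h)).
  rewrite (big_centre (F := fun v => u v (val l))) ?(magic_col gm) // => v /negPf ntv.
  by apply: (qinv1_0 qinv1_top); rewrite ntv tT.
- rewrite mulr_suml big1 // => y yl; rewrite mulr_sumr big1 // => y' yl'.
  rewrite (magic_orthr gm) //; apply: contra_neq ll' => yy'.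
  by apply: (centre_uniq h_uniq yl); rewrite yy'.
- rewrite mulr_suml big1 // => y yl; rewrite mulr_sumr big1 // => y' yl'.
  apply: (qinv2_mul0 qinv2_sibling).
  have -> : sibling h y y' by apply: (sibling_trans h_uniq yl); rewrite sibling_sym.
  apply: contra_neqN kk' => /eqP kk'; apply: (centre_uniq h_uniq _ kk').
  exact: sibling_refl.
Qed.

Lemma qinv2_vertex_centre v v' k k' :
  u v v' * centre_mx k k' != 0 -> sibling h v (val k) = sibling h v' (val k').
Proof.
apply: contra_neq_eq => ne; rewrite /centre_mx mulr_sumr big1 // => y yk'.
apply: (qinv2_mul0 qinv2_sibling); apply: contra_neq ne => ->.
apply/idP/idP => [/(sibling_trans h_uniq)|y'k']; first exact.
by apply: (sibling_trans h_uniq y'k'); rewrite sibling_sym.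
Qed.

Lemma qinv2_centre_vertex v v' k k' :
  centre_mx k k' * u v v' != 0 -> sibling h v (val k) = sibling h v' (val k').
Proof.
move=> nz; apply: qinv2_vertex_centre; apply: contra_neq nz => z0.
rewrite -[LHS]starK starM (magic_star gm) (magic_star centre_magic) z0.
exact: star0.
Qed.

Definition core_mx : core h -> core h -> A := dsum u centre_mx.

(** Copying [core_mx] on the leaves reduces the leaf edges to [qinv2_eq]. *)
Definition join_mx : join h -> join h -> A :=
  dsum (dsum core_mx core_mx) (fun _ _ => 1).

Lemma join_mx_graph_magic : graph_magic join_mx.
Proof.
have cm : magic core_mx by apply: dsum_magic centre_magic; apply: gm.
have ceq := qinv2_eq cm.
apply: qinv2_graph_magic.
  by apply: dsum_magic (magic_unit A); apply: dsum_magic.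
move=> [[x|x]|[]] [[x'|x']|[]] s s'; rewrite /= ?mul0r ?eqxx //;
  case: s s' => [[y|y]|[]] [[y'|y']|[]] //=; rewrite ?mulr0 ?eqxx //; try exact: ceq.
- case: x x' y y' => [v|k] [v'|k'] [w|l] [w'|l'] //=; rewrite ?(mulr0, mul0r) ?eqxx //.
  + move=> nz; rewrite (eu nz); congr (_ && (_ != _)).
      exact: hu (mul_neq0l nz).
    exact: hu (mul_neq0r nz).
  + exact: qinv2_vertex_centre.
  + exact: qinv2_centre_vertex.
- by move=> /ceq; case: x; case: x'.
- by case: x x' => [v|k] [v'|k'] //=; rewrite ?(mulr0, mul0r) ?eqxx.
- by case: y y' => [v|k] [v'|k'] //=; rewrite ?(mulr0, mul0r) ?eqxx.
Qed.

End Lift.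

(** * Restricting magic unitaries of the tree to the forest *)

Section Restrict.
Variables k1 k2 : centre h.
Hypothesis k12 : k1 != k2.

Definition is_leaf (s : join h) : bool :=
  if s is inl (inr _) then true else false.
Definition is_centre (s : join h) : bool :=
  if s is inl (inl (inr _)) then true else false.
Definition is_hub (s : join h) : bool := if s is inr _ then true else false.

(** Besides its own leaf, a centre is adjacent to the hub, a top to its centre, and any other vertex
    to a higher one. *)
Lemma core_degree_gt1 x : (1 < #|[pred t : join h | edge (in_core x) t]|)%N.
Proof.
have [t [xt tl]] : exists t : join h, edge (in_core x) t /\ t != in_leaf x.
  case: x => [v|k]; last by exists (hub h).
  have [/(sibling_centre h_uniq)[k vk]|] := boolP (top h v).
    by exists (in_core (inr k)).
  case/forallPn => w; rewrite negb_imply -ltnNge => /andP[vw hvw].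
  by exists (in_core (inl w)); rewrite /= vw neq_ltn hvw.
apply/card_gt1P; exists t, (in_leaf x); split=> //.
by rewrite inE edge_core_leaf.
Qed.

(** The two centres give the hub degree at least two, so that degree one singles out the leaves. *)
Lemma is_leafE s : is_leaf s = (#|[pred t : join h | edge s t]| == 1)%N.
Proof.
case: s => [[x|x]|[]].
- by rewrite gtn_eqF // core_degree_gt1.
- apply/esym/eqP; rewrite -(card1 (in_core x : join h)).
  by apply: eq_card => -[[y|y]|[]]; rewrite !inE //= eq_sym.
- rewrite gtn_eqF //; apply/card_gt1P.
  by exists (in_core (inr k1)), (in_core (inr k2)); split.
Qed.

Lemma is_hubE s : is_hub s =
  ~~ is_leaf s && (#|[pred t : join h | edge s t && is_leaf t]| == 0)%N.
Proof.
case: s => [[x|x]|[]] //.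
  apply/esym/negbTE; rewrite negb_and; apply/orP; right.
  rewrite -lt0n; apply/card_gt0P.
  by exists (in_leaf x); rewrite inE edge_core_leaf eqxx.
by apply/esym/eqP/eq_card0 => -[[[y|y]|y]|[]].
Qed.

Lemma is_centreE s : is_centre s =
  (#|[pred t : join h | edge s t && is_hub t]| != 0)%N.
Proof.
have none t : (forall m : join h, ~~ (edge t m && is_hub m)) ->
    (#|[pred m : join h | edge t m && is_hub m]| != 0)%N = false.
  by move=> no; rewrite eq_card0 // => m; apply/negbTE/no.
case: s => [[[v|k]|x]|[]]; apply/esym.
- by apply: none => -[m|[]] //; rewrite andbF.
- by rewrite -lt0n; apply/card_gt0P; exists (hub h).
- by apply: none => -[m|[]] //; rewrite andbF.
- by apply: none => -[m|[]] //; rewrite andbF.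
Qed.

Section Invariants.
Variable w : join h -> join h -> A.
Hypothesis gm : graph_magic w.

Let ew := graph_magic_qinv2 gm.

Lemma qinv1_leaf : qinv1 w is_leaf.
Proof.
apply: eq_qinv1 (fun s => esym (is_leafE s)) _.
exact: (qinv1_comp (eq_op^~ 1%N)) (qinv1_count gm ew).
Qed.

Lemma qinv1_hub : qinv1 w is_hub.
Proof.
apply: eq_qinv1 (fun s => esym (is_hubE s)) _.
apply: (qinv1_op andb); first exact: qinv1_comp qinv1_leaf.
exact: (qinv1_comp (eq_op^~ 0%N)) (qinv1_card_nbr gm ew qinv1_leaf).
Qed.

Lemma qinv1_centre : qinv1 w is_centre.
Proof.
apply: eq_qinv1 (fun s => esym (is_centreE s)) _.
exact: (qinv1_comp (fun n => n != 0%N)) (qinv1_card_nbr gm ew qinv1_hub).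
Qed.

(** The vertices of [G] are those for which all three values are false. *)
Definition kind (s : join h) := (is_leaf s, is_hub s, is_centre s).

Lemma qinv1_kind : qinv1 w kind.
Proof.
by move=> s t nz; rewrite /kind (qinv1_leaf nz) (qinv1_hub nz) (qinv1_centre nz).
Qed.

Lemma magic_kind_neq s t : kind s != kind t -> w s t = 0.
Proof. exact: qinv1_0 qinv1_kind. Qed.

Definition in_vertex (v : G) : join h := in_core (inl v).

Definition restr_mx (v v' : G) : A := w (in_vertex v) (in_vertex v').

Lemma big_vertex (F : join h -> A) :
  (forall s, kind s != (false, false, false) -> F s = 0) ->
  \sum_s F s = \sum_v F (in_vertex v).
Proof.
move=> F0; transitivity (\sum_(s : (core h + core h) + unit) F s); first by [].
rewrite !big_sumType /= !addrA.
by do 4![rewrite [X in _ + X]big1 ?addr0 => [|s _]; last exact: F0].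
Qed.

(** By [edge_split], the edges missing from the tree join distinct vertices with a common centre.
    The right side is built from relations that [w] respects. *)
Lemma edge_join (v v' : G) : edge v v' =
  edge (in_vertex v) (in_vertex v') || (in_vertex v != in_vertex v') &&
    (#|[pred m | (edge (in_vertex v) m && is_centre m) &&
                 edge m (in_vertex v')]| != 0)%N.
Proof.
rewrite (edge_split h_uniq) -lt0n; congr (_ || (_ && _)).
apply/andP/card_gt0P => [[/(sibling_centre h_uniq)[k vk] vv']|].
  exists (in_core (inr k)); rewrite !inE /= vk /=.
  by apply: (sibling_trans h_uniq) vk; rewrite sibling_sym.
move=> [[[[y|k]|y]|[]]]; rewrite !inE /= ?andbF // andbT => /andP[vk v'k].
split; first by rewrite (sibling_top h_uniq vk) centre_top.
by apply: (sibling_trans h_uniq vk); rewrite sibling_sym.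
Qed.

(** Entries between different kinds vanish, so row and column sums reduce to the vertices of [G];
    [edge_join] handles the edges. *)
Lemma restr_mx_graph_magic : graph_magic restr_mx.
Proof.
apply: qinv2_graph_magic; first split.
- by move=> v v'; apply: magic_star gm _ _.
- by move=> v v'; apply: magic_idem gm _ _.
- move=> v; rewrite -(magic_row gm (in_vertex v)) big_vertex // => s ks.
  by apply: magic_kind_neq; rewrite eq_sym.
- move=> v; rewrite -(magic_col gm (in_vertex v)) big_vertex // => s ks.
  exact: magic_kind_neq.
- by move=> v v' v'' ne; apply: magic_orthr gm _ _ _ _; apply: contra_neq ne => -[].
- by move=> v v' v'' ne; apply: magic_orthc gm _ _ _ _; apply: contra_neq ne => -[].
move=> v v' x x' nz; rewrite !edge_join.
have cw := qinv2_count gm (qinv2_op andb ew (qinv1_r qinv1_centre)) ew.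
have := qinv2_op orb ew (qinv2_op andb (qinv2_comp negb (qinv2_eq gm))
  (qinv2_comp (fun n => n != 0%N) cw)).
exact.
Qed.

End Invariants.

Section Uniqueness.
Variables w w' : join h -> join h -> A.
Hypotheses (gm : graph_magic w) (gm' : graph_magic w').
Hypothesis ww' : forall v v',
  w (in_vertex v) (in_vertex v') = w' (in_vertex v) (in_vertex v').

Lemma magic_functional_eq (R : rel (join h)) s t x :
    qinv2 w R -> qinv2 w' R -> (forall t1 t2 y, R t1 y -> R t2 y -> t1 = t2) ->
    R s x -> (forall y, R t y -> w x y = w' x y) -> w s t = w' s t.
Proof.
move=> Rw Rw' Rfun Rsx wE.
rewrite (magic_functional gm t Rw Rfun Rsx) (magic_functional gm' t Rw' Rfun Rsx).
exact: eq_bigr.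
Qed.

(** Entries vanish across kinds; the vertices determine the centres, the core determines the leaves,
    and the hub entry is 1. *)
Lemma join_magic_uniq s t : w s t = w' s t.
Proof.
have [kst|nk] := eqVneq (kind s) (kind t); last first.
  by rewrite (magic_kind_neq gm) // (magic_kind_neq gm').
have Rq (u : join h -> join h -> A) (f : join h -> bool) (g : join h -> bool) :
    graph_magic u -> qinv1 u f -> qinv1 u g ->
    qinv2 u (fun s t => (f s && g t) && edge s t).
  move=> gu fu gu'; apply: (qinv2_op andb) (graph_magic_qinv2 gu).
  exact: (qinv2_op andb) (qinv1_l fu) (qinv1_r gu').
have wcc k l :
    w (in_core (inr k)) (in_core (inr l)) = w' (in_core (inr k)) (in_core (inr l)).
  pose orig (s : join h) := kind s == (false, false, false).
  have oq (u : join h -> join h -> A) : graph_magic u -> qinv1 u orig.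
    by move=> gu s1 s2 nz; rewrite /orig (qinv1_kind gu nz).
  (* A vertex of [G] is attached to at most one centre. *)
  apply: (@magic_functional_eq (fun s t => (is_centre s && orig t) && edge s t) _ _
      (in_vertex (val k))).
  - by apply: Rq; [|apply: qinv1_centre|apply: oq].
  - by apply: Rq; [|apply: qinv1_centre|apply: oq].
  - move=> [[[?|k']|?]|[]] [[[?|l']|?]|[]] [[[v|?]|?]|[]] //= vk vl.
    by rewrite (centre_uniq h_uniq vk vl).
  - exact: sibling_refl.
  - by move=> [[[v|?]|?]|[]] //= _; apply: ww'.
have wc x y : w (in_core x) (in_core y) = w' (in_core x) (in_core y).
  case: x y => [v|k] [v'|k']; [exact: ww'| | |exact: wcc];
    by rewrite (magic_kind_neq gm) // (magic_kind_neq gm').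
case: s t kst => [[x|x]|[]] [[y|y]|[]] //= _; first exact: wc.
  (* A core vertex carries only one leaf. *)
  apply: (@magic_functional_eq (fun s t => (is_leaf s && true) && edge s t) _ _
      (in_core x)).
  - by apply: Rq => //; apply: qinv1_leaf.
  - by apply: Rq => //; apply: qinv1_leaf.
  - by move=> [[?|x1]|[]] [[?|x2]|[]] [[z|?]|[]] //= /eqP-> /eqP->.
  - by case: x => ? /=; rewrite eqxx.
  - by move=> [[z|?]|[]] //= _; apply: wc.
have whub (u : join h -> join h -> A) : graph_magic u -> u (hub h) (hub h) = 1.
  move=> gu; rewrite -(magic_row gu (hub h)) (bigD1 (hub h)) //= big1 ?addr0 //.
  by move=> [[t|t]|[]] // _; rewrite (magic_kind_neq gu) //; case: t.
by rewrite !whub.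
Qed.

End Uniqueness.

End Restrict.

End JoinMagic.

(** * Isomorphisms of quantum permutation groups *)

Section StarComp.
Variables (C : numClosedFieldType) (A B D : starAlgType C).
Variables (f : {starmorphism A -> B}) (g : {starmorphism B -> D}).

Fact comp_star_morph a : (g \o f) (star a) = star ((g \o f) a).
Proof. by rewrite /= !star_morph. Qed.

HB.instance Definition _ :=
  isStarPreserving.Build C A D (g \o f) comp_star_morph.

HB.instance Definition _ :=
  isStarPreserving.Build C A A (@idfun A) (fun=> erefl).

Definition star_comp : {starmorphism A -> D} := g \o f.

End StarComp.

Section TensorMapMorphism.
Variables (C : numClosedFieldType) (A B A' B' : starAlgType C).
Variables (f : {starmorphism A -> A'}) (g : {starmorphism B -> B'}).

Let bal := tensor_map_balanced f g.

Lemma tensor_mapD : {morph tensor_map f g : x y / x + y}.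
Proof. by move=> x y; rewrite /tensor_map tliftDE. Qed.

Lemma tensor_map_sum (I : Type) (r : seq I) (F : I -> tensor A B) :
  tensor_map f g (\sum_(i <- r) F i) = \sum_(i <- r) tensor_map f g (F i).
Proof. by apply: (big_morph _ tensor_mapD); apply: tlift0. Qed.

Lemma tensor_mapZ k : {morph tensor_map f g : x / k *: x}.
Proof.
move=> x; rewrite (tensor_sumE x) scaler_sumr !tensor_map_sum scaler_sumr.
by apply: eq_bigr => p _; rewrite tpureZ !tensor_map_pure linearZ tpureZ.
Qed.

Lemma tensor_map1 : tensor_map f g 1 = 1.
Proof. by rewrite -tpure1 tensor_map_pure !rmorph1. Qed.

Lemma tensor_mapM : {morph tensor_map f g : x y / x * y}.
Proof.
move=> x y; rewrite (tensor_sumE x) (tensor_sumE y) !tensor_map_sum !mulr_suml.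
rewrite tensor_map_sum; apply: eq_bigr => p _; rewrite !mulr_sumr tensor_map_sum.
by apply: eq_bigr => q _; rewrite !(tpureM, tensor_map_pure) !rmorphM.
Qed.

Lemma tensor_map_star : {morph tensor_map f g : x / star x}.
Proof.
move=> x; rewrite (tensor_sumE x) !(star_sum, tensor_map_sum).
by apply: eq_bigr => p _; rewrite !(star_tpure, tensor_map_pure) !star_morph.
Qed.

End TensorMapMorphism.

Lemma tensor_map_comp (C : numClosedFieldType) (A B D : starAlgType C)
    (f : {starmorphism A -> B}) (g : {starmorphism B -> D}) x :
  tensor_map (star_comp f g) (star_comp f g) x =
  tensor_map g g (tensor_map f f x).
Proof.
rewrite (tensor_sumE x) !tensor_map_sum; apply: eq_bigr => p _.
by rewrite !tensor_map_pure.
Qed.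

Lemma qiso_trans (C : numClosedFieldType) (Gamma Lambda Theta : qpermgroup C) :
  qiso Gamma Lambda -> qiso Lambda Theta -> qiso Gamma Theta.
Proof.
move=> [f fbij fcomul] [g gbij gcomul]; exists (star_comp f g).
  exact: bij_comp.
by move=> a; rewrite tensor_map_comp -fcomul -gcomul.
Qed.

(** Reduces compatibility with the comultiplications to a check on generators. *)
Lemma comul_compat_subalgebra (C : numClosedFieldType) (A B : starAlgType C)
    (dA : {starmorphism A -> tensor A A}) (dB : {starmorphism B -> tensor B B})
    (f : {starmorphism A -> B}) :
  star_subalgebra (fun a => dB (f a) = tensor_map f f (dA a)).
Proof.
split=> [|k a b ha hb|a b ha hb|a ha].
- by rewrite !rmorph1 tensor_map1.
- by rewrite !linearP tensor_mapD tensor_mapZ -ha -hb.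
- by rewrite !rmorphM tensor_mapM -ha -hb.
- by rewrite !star_morph tensor_map_star -ha.
Qed.

(** * Isomorphisms induced by restricting the generators *)

Section QuMorphisms.
Variable C : numClosedFieldType.

Lemma graph_magic_morph (G : sgraph) (A B : starAlgType C)
    (f : {starmorphism A -> B}) (v : G -> G -> A) :
  graph_magic v -> graph_magic (fun x y => f (v x y)).
Proof.
move=> gm; split; first split.
- by move=> x y; rewrite -star_morph (magic_star gm).
- by move=> x y; rewrite -rmorphM (magic_idem gm).
- by move=> x; rewrite -raddf_sum (magic_row gm) /= rmorph1.
- by move=> x; rewrite -raddf_sum (magic_col gm) /= rmorph1.
- by move=> x y z yz; rewrite -rmorphM (magic_orthr gm) // raddf0.
- by move=> x y z yz; rewrite -rmorphM (magic_orthc gm) // raddf0.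
- move=> x y; have := congr1 f (graph_magic_adj gm x y); rewrite !raddf_sum /=.
  by under eq_bigr do rewrite linearZ; under [in RHS]eq_bigr do rewrite linearZ.
Qed.

Lemma eq_qu_morphism (G : sgraph) (A : starAlgType C)
    (f g : {starmorphism qualg C G -> A}) :
  (forall x y, f (qu C x y) = g (qu C x y)) -> f =1 g.
Proof.
move=> fg a; have gv := graph_magic_morph g (qu_graph_magic C G).
by rewrite (qu_lift_uniq gv fg) (qu_lift_uniq (f := g) gv).
Qed.

Variables (G T : sgraph) (i : G -> T).
Hypothesis restr : forall (A : starAlgType C) (w : T -> T -> A),
  graph_magic w -> graph_magic (fun x y => w (i x) (i y)).
Hypothesis delta_restr : forall x y,
  qu_delta C (i x) (i y) = \sum_z qu C (i x) (i z) ⊗ qu C (i z) (i y).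
Hypothesis lift : forall (A : starAlgType C) (u : G -> G -> A), graph_magic u ->
  exists2 w : T -> T -> A, graph_magic w & forall x y, w (i x) (i y) = u x y.
Hypothesis uniq_lift : forall (A : starAlgType C) (w w' : T -> T -> A),
  graph_magic w -> graph_magic w' ->
  (forall x y, w (i x) (i y) = w' (i x) (i y)) -> forall s t, w s t = w' s t.

(** Universality turns [restr] and [lift] into morphisms in both directions. One composite is the
    identity on generators by [wE]; for the other, [uniq_lift] reduces the comparison with the
    identity to the image of [i]. *)
Lemma qiso_restriction : qiso (Qu C G) (Qu C T).
Proof.
pose phi := qu_lift (restr (qu_graph_magic C T)).
have phiE x y : phi (qu C x y) = qu C (i x) (i y) by exact: qu_liftE.
have [w gw wE] := lift (qu_graph_magic C G).
exists phi.
  have psiE s t : qu_lift gw (qu C s t) = w s t by exact: qu_liftE.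
  exists (qu_lift gw).
    apply: (eq_qu_morphism (f := star_comp phi (qu_lift gw)) (g := idfun)) => x y.
    by rewrite /= phiE psiE wE.
  apply: (eq_qu_morphism (f := star_comp (qu_lift gw) phi) (g := idfun)) => s t.
  rewrite /= psiE; move: s t; apply: uniq_lift.
  - exact: (graph_magic_morph phi gw).
  - exact: qu_graph_magic.
  - by move=> x y; rewrite wE phiE.
(* On generators, [delta_restr] cuts the sum over [T] down to the image of [i]. *)
apply: (qgen_generated (q := Qu C G) (comul_compat_subalgebra _ _ phi)).
move=> _ [x [y ->]]; rewrite (qcomulE (q := Qu C G)).
have -> : phi (qgen (q := Qu C G) x y) = qu C (i x) (i y) by apply: phiE.
rewrite (qcomulE (q := Qu C T) (i x) (i y)) tensor_map_sum.
under [RHS]eq_bigr do rewrite tensor_map_pure !phiE.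
exact: delta_restr.
Qed.

End QuMorphisms.

(** * From forests to trees *)

Lemma qiso_join (C : numClosedFieldType) (G : sgraph) (h : G -> nat)
    (k1 k2 : centre h) :
  (forall v w1 w2 : G, edge v w1 -> edge v w2 ->
     (h v <= h w1)%N -> (h v <= h w2)%N -> w1 = w2) ->
  (forall (A : starAlgType C) (u : G -> G -> A), graph_magic u -> qinv1 u h) ->
  k1 != k2 -> qiso (Qu C G) (Qu C (join h)).
Proof.
move=> h_uniq hinv k12; apply: (@qiso_restriction C G (join h) (@in_vertex G h)).
- by move=> A w gm; exact: (restr_mx_graph_magic h_uniq k12 gm).
(* Terms passing through another kind have a zero left factor. *)
- move=> x y; apply: big_vertex => s ks.
  rewrite (magic_kind_neq h_uniq k12 (qu_graph_magic C _)) 1?eq_sym //.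
  exact: bal0l (balanced_tpure _ _) _.
- move=> A u gm; have hu := hinv A u gm.
  by exists (join_mx u) => //; apply: join_mx_graph_magic.
- by move=> A w w' gm gm' ww'; exact: (join_magic_uniq h_uniq k12 gm gm' ww').
Qed.

Lemma forest_tree_qiso (C : numClosedFieldType) (F : sgraph) : is_forest F ->
  exists2 T : sgraph, is_tree T & qiso (Qu C F) (Qu C T).
Proof.
move=> /forest_acyclic ac.
(* Pruning starts from all vertices, where membership is trivially invariant. *)
have [h [h_le1 h_inv]] := pruning_height setT ac.
have h_uniq (v w1 w2 : F) : edge v w1 -> edge v w2 ->
    (h v <= h w1)%N -> (h v <= h w2)%N -> w1 = w2.
  move=> e1 e2 h1 h2; have /card_le1_eqP := h_le1 v (in_setT v).
  by apply; rewrite !inE ?e1 ?e2 ?h1 ?h2.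
(* With two distinct centres the join is the tree; otherwise the forest is already one. *)
have [[[k1 k2] k12]|one] := pselect (exists k : centre h * centre h, k.1 != k.2).
  exists (join h); first exact: join_is_tree.
  by apply: qiso_join k12 => // A u gm; apply: h_inv gm _ => i j _; rewrite !inE.
exists F; last first.
  exists idfun; first by exists idfun.
  (* A tensor is the sum of the pure tensors of its representative, so the identity induces the
     identity. *)
  move=> a; rewrite /= [LHS]tensor_sumE [RHS]/tensor_map.
  by rewrite /tlift /teval.
apply: (one_centre_is_tree h_uniq ac) => k l.
by apply/eqP/negPn/negP => kl; apply: one; exists (k, l).
Qed.

Theorem corollary6p29 (R : realType) (Gamma : qpermgroup R[i]) :
  (exists F : sgraph, is_forest F /\ qiso Gamma (Qu R[i] F)) <->
  (exists T : sgraph, is_tree T /\ qiso Gamma (Qu R[i] T)).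
Proof.
split=> [[F [fF isoF]]|[T [tT isoT]]].
  have [T tT isoT] := forest_tree_qiso R[i] fF.
  by exists T; split=> //; apply: qiso_trans isoT.
by exists T; split=> //; apply: tree_forest.
Qed.
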